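(* Let $k$ be a nonzero commutative ring with $\operatorname{sfli}k<\infty$ and let $n$ be a nonnegative integer. Then there exists a countable group $G$ such that $$\operatorname{Ghd}_kG=n\quad\text{and}\quad\operatorname{Gcd}_kG=\widetilde{\operatorname{Gcd}}_kG=n+1=\operatorname{Ghd}_kG+1.$$
   Context: Rings are associative with unit and modules are left modules unless stated otherwise. For a ring $R$, $\operatorname{sfli}R$ is the supremum of the flat dimensions of the injective $R$-modules. For a ring $R$: a module is Gorenstein flat if it is a cycle of an acyclic ($\mathbb{Z}$-indexed) complex $\mathbf F$ of flat $R$-modules such that $I\otimes_R\mathbf F$ is acyclic for every injective right $R$-module $I$; it is projectively coresolved Gorenstein flat (PGF) if it is a cycle of an acyclic complex $\mathbf P$ of projective $R$-modules such that $I\otimes_R\mathbf P$ is acyclic for every injective right $R$-module $I$; it is Gorenstein projective if it is a cycle of an acyclic complex $\mathbf P$ of projective $R$-modules such that $\operatorname{Hom}_R(\mathbf P,Q)$ is acyclic for every projective $R$-module $Q$. The dimensions $\operatorname{Gfd}_RM$, $\operatorname{PGF-dim}_RM$ and $\operatorname{Gpd}_RM$ are the least $n\ge0$ for which there is an exact sequence $0\to X_n\to\cdots\to X_0\to M\to0$ with all $X_i$ Gorenstein flat, PGF, Gorenstein projective, respectively, and $\infty$ if there is no such $n$. For a group $G$ and a commutative ring $k$, regard $k$ as a trivial module over the group algebra $kG$ and set $\operatorname{Ghd}_kG=\operatorname{Gfd}_{kG}k$, $\operatorname{Gcd}_kG=\operatorname{Gpd}_{kG}k$, $\widetilde{\operatorname{Gcd}}_kG=\operatorname{PGF-dim}_{kG}k$.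 *)

(* Defs.v *)
From HB Require Import structures.
From mathcomp Require Import all_boot all_order all_algebra.
From mathcomp Require Import finmap.
From mathcomp Require Import boolp classical_sets cardinality.
From mathcomp.multinomials Require Import monalg.

Set Implicit Arguments.
Unset Strict Implicit.
Unset Printing Implicit Defensive.

Import GRing.Theory.
Local Open Scope ring_scope.
Local Open Scope quotient_scope.

(* Conventions: rings are of type pzRingType, left R-modules are lmodType R,
   right R-modules are lmodType R^c (so that (r : R^c) *: x stands for x r).
   Values in {0, 1, 2, ...} together with infinity are of type option nat, with
   None for infinity. *)

(* The tensor product of a right module A and a left module B: the free abelian
   group on A * B modulo the usual relations. *)
Section Tensor.
Variables (R : pzRingType) (A : lmodType R^c) (B : lmodType R).

Inductive tensor_rel : {malg int[(A * B)%type]} -> Prop :=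
| TensorRel0 : tensor_rel 0
| TensorRelB x y : tensor_rel x -> tensor_rel y -> tensor_rel (x - y)
| TensorRelDl a a' b :
    tensor_rel (<< (a + a', b) >> - << (a, b) >> - << (a', b) >>)
| TensorRelDr a b b' :
    tensor_rel (<< (a, b + b') >> - << (a, b) >> - << (a, b') >>)
| TensorRelZ a (r : R) b :
    tensor_rel (<< ((r : R^c) *: a, b) >> - << (a, r *: b) >>).

Definition tensor_relb : {pred {malg int[(A * B)%type]}} :=
  fun z => `[< tensor_rel z >].

Fact tensor_relb_zmod_closed : zmod_closed tensor_relb.
Proof.
split; first by apply/asboolP; exact: TensorRel0.
by move=> x y /asboolP hx /asboolP hy; apply/asboolP; exact: TensorRelB.
Qed.

HB.instance Definition _ :=
  GRing.isZmodClosed.Build {malg int[(A * B)%type]} tensor_relb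
    tensor_relb_zmod_closed.

Definition tensor := Quotient.quot tensor_relb.

HB.instance Definition _ := GRing.Zmodule.on tensor.

Definition tens (a : A) (b : B) : tensor := \pi_(tensor) << (a, b) >>.

End Tensor.

Section MalgMap.
Variables (K L : choiceType) (h : K -> L).

Definition malg_map (z : {malg int[K]}) : {malg int[L]} :=
  \sum_(k <- msupp z) << z@_k *g h k >>.

Lemma malg_mapEw (d : {fset K}) (z : {malg int[K]}) : (msupp z `<=` d)%fset ->
  malg_map z = \sum_(k <- d) << z@_k *g h k >>.
Proof.
move=> le_d; rewrite /malg_map (big_fset_incl _ le_d) // => k _ /mcoeff_outdom ->.
by rewrite monalgU0.
Qed.

Lemma malg_map_is_zmod_morphism : zmod_morphism malg_map.
Proof.
move=> x y.
rewrite (malg_mapEw (msuppB_le x y)) (malg_mapEw (fsubsetUl _ (msupp y))).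
rewrite (malg_mapEw (fsubsetUr (msupp x) _)) -sumrB.
by apply: eq_bigr => k _; rewrite mcoeffB monalgUB.
Qed.

HB.instance Definition _ :=
  GRing.isZmodMorphism.Build {malg int[K]} {malg int[L]} malg_map
    malg_map_is_zmod_morphism.

Lemma malg_mapU k : malg_map << k >> = << h k >>.
Proof. by rewrite (malg_mapEw msuppU_le) big_seq_fset1 mcoeffUU. Qed.

End MalgMap.

Section TensorMap.
Variables (R : pzRingType) (A A' : lmodType R^c) (B B' : lmodType R).
Variables (f : {linear A -> A'}) (g : {linear B -> B'}).

Let h (p : A * B) : A' * B' := (f p.1, g p.2).

Definition tensor_map (z : tensor A B) : tensor A' B' :=
  \pi_(tensor A' B') (malg_map h (repr z)).

Lemma tensor_rel_map z : tensor_rel z -> tensor_rel (malg_map h z).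
Proof.
elim=> [|x y _ hx _ hy|a a' b|a b b'|a r b].
- by rewrite raddf0; exact: TensorRel0.
- by rewrite raddfB; exact: TensorRelB.
- by rewrite !raddfB /= !malg_mapU /h /= raddfD; exact: TensorRelDl.
- by rewrite !raddfB /= !malg_mapU /h /= raddfD; exact: TensorRelDr.
- by rewrite raddfB /= !malg_mapU /h /= !linearZ; exact: TensorRelZ.
Qed.

Lemma tensor_map_pi z :
  tensor_map (\pi_(tensor A B) z) = \pi_(tensor A' B') (malg_map h z).
Proof.
apply/eqP; rewrite -Quotient.idealrBE -raddfB.
apply/asboolP/tensor_rel_map/asboolP.
rewrite -[asbool _]/(_ \in tensor_relb (A:=A) (B:=B)).
by rewrite Quotient.idealrBE reprK.
Qed.

Lemma tensor_mapE a b : tensor_map (tens a b) = tens (f a) (g b).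
Proof. by rewrite /tens tensor_map_pi malg_mapU. Qed.

Lemma tensor_map_is_zmod_morphism : zmod_morphism tensor_map.
Proof.
move=> x y; rewrite -[x]reprK -[y]reprK -raddfB !tensor_map_pi.
by rewrite !raddfB.
Qed.

HB.instance Definition _ :=
  GRing.isZmodMorphism.Build (tensor A B) (tensor A' B') tensor_map
    tensor_map_is_zmod_morphism.

End TensorMap.

Definition exact_at (U V W : zmodType) (f : U -> V) (g : V -> W) : Prop :=
  forall y, g y = 0 <-> exists x, f x = y.

Section Modules.
Variable R : pzRingType.

Definition projective_module (P : lmodType R) : Prop :=
  forall (A B : lmodType R) (p : {linear A -> B}) (f : {linear P -> B}),
    (forall y, exists x, p x = y) ->
    exists f' : {linear P -> A}, forall x, p (f' x) = f x.

Definition injective_module (E : lmodType R) : Prop :=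
  forall (A B : lmodType R) (j : {linear A -> B}) (f : {linear A -> E}),
    injective j -> exists f' : {linear B -> E}, forall x, f' (j x) = f x.

Definition flat_module (M : lmodType R) : Prop :=
  forall (A B C : lmodType R^c) (f : {linear A -> B}) (g : {linear B -> C}),
    exact_at f g ->
    exact_at (tensor_map f (@idfun M)) (tensor_map g (@idfun M)).

End Modules.

Section Complexes.
Variable R : pzRingType.

Record complex := Complex {
  obj :> int -> lmodType R;
  diff : forall i : int, {linear obj (i + 1) -> obj i};
  diff_diff : forall i x, diff i (diff (i + 1) x) = 0
}.

Definition acyclic (F : complex) : Prop :=
  forall i, exact_at (diff F (i + 1)) (diff F i).

Definition tensor_acyclic (I : lmodType R^c) (F : complex) : Prop :=
  forall i, exact_at (tensor_map (@idfun I) (diff F (i + 1)))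
                     (tensor_map (@idfun I) (diff F i)).

(* Acyclicity of Hom(F, Q), whose differentials are the precompositions with
   those of F; equality of linear maps is stated pointwise. *)
Definition hom_acyclic (F : complex) (Q : lmodType R) : Prop :=
  forall i (u : {linear F (i + 1) -> Q}),
    (forall x, u (diff F (i + 1) x) = 0) <->
    exists v : {linear F i -> Q}, forall x, v (diff F i x) = u x.

(* M is isomorphic to the kernel of a differential of F *)
Definition is_cycle_of (M : lmodType R) (F : complex) : Prop :=
  exists i (j : {linear M -> F (i + 1)}),
    injective j /\ exact_at j (diff F i).

End Complexes.

Section Gorenstein.
Variable R : pzRingType.

Definition gorenstein_flat (M : lmodType R) : Prop :=
  exists F : complex R,
    [/\ forall i, flat_module (F i),
        acyclic F,
        forall I : lmodType R^c, injective_module I -> tensor_acyclic I F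
      & is_cycle_of M F].

Definition PGF (M : lmodType R) : Prop :=
  exists P : complex R,
    [/\ forall i, projective_module (P i),
        acyclic P,
        forall I : lmodType R^c, injective_module I -> tensor_acyclic I P
      & is_cycle_of M P].

Definition gorenstein_projective (M : lmodType R) : Prop :=
  exists P : complex R,
    [/\ forall i, projective_module (P i),
        acyclic P,
        forall Q : lmodType R, projective_module Q -> hom_acyclic P Q
      & is_cycle_of M P].

End Gorenstein.

(* The infimum of P in {0, 1, ..., infinity} *)
Definition inf_nat (P : nat -> Prop) : option nat :=
  if pselect (exists n, `[< P n >]) is left exP then Some (ex_minn exP)
  else None.

Definition dim_le (d : option nat) (n : nat) : bool :=
  if d is Some m then (m <= n)%N else false.

Section Dimensions.
Variable R : pzRingType.

(* An exact sequence 0 -> X_n -> ... -> X_0 -> M -> 0 with all X_i in the class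
   C, encoded as an infinite one with X_i = 0 for i > n *)
Definition has_resolution (C : lmodType R -> Prop) (M : lmodType R) (n : nat) :
    Prop :=
  exists (X : nat -> lmodType R) (d : forall i, {linear X i.+1 -> X i})
         (e : {linear X 0%N -> M}),
    [/\ forall i, (i <= n)%N -> C (X i),
        forall i, (n < i)%N -> forall x : X i, x = 0,
        forall m, exists x, e x = m,
        exact_at (d 0%N) e
      & forall i, exact_at (d i.+1) (d i)].

Definition resolution_dim (C : lmodType R -> Prop) (M : lmodType R) :
    option nat :=
  inf_nat (has_resolution C M).

Definition fd := resolution_dim (@flat_module R).
Definition Gfd := resolution_dim (@gorenstein_flat R).
Definition PGF_dim := resolution_dim (@PGF R).
Definition Gpd := resolution_dim (@gorenstein_projective R).

(* The supremum, as the least upper bound in {0, 1, ..., infinity} *)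
Definition sfli : option nat :=
  inf_nat (fun n => forall E : lmodType R, injective_module E ->
                    dim_le (fd E) n).

End Dimensions.

Section GroupAlgebra.
Variables (k : comNzRingType) (G : groupType).

(* Not {malg k[G]} itself, whose ring structure in the library is restricted to
   monoids without nontrivial units. *)
Definition group_alg : Type := {malg k[G]}.

HB.instance Definition _ := GRing.Lmodule.on group_alg.

Implicit Types a b c : group_alg.

Definition ga_one : group_alg := << 1%g >>.

Definition ga_mul a b : group_alg :=
  \sum_(x <- msupp a) \sum_(y <- msupp b) << a@_x * b@_y *g (x * y)%g >>.

Lemma ga_mulEw (d1 d2 : {fset G}) a b :
  (msupp a `<=` d1)%fset -> (msupp b `<=` d2)%fset ->
  ga_mul a b = \sum_(x <- d1) \sum_(y <- d2) << a@_x * b@_y *g (x * y)%g >>.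
Proof.
move=> le_d1 le_d2; rewrite /ga_mul (big_fset_incl _ le_d1) /=.
  apply/eq_bigr=> x _; apply/big_fset_incl => // y _ /mcoeff_outdom ->.
  by rewrite mulr0 monalgU0.
move=> x _ /mcoeff_outdom ax.
by rewrite big1 => // y _; rewrite ax mul0r monalgU0.
Qed.

Lemma ga_mulDl : left_distributive ga_mul +%R.
Proof.
move=> a b c; rewrite (ga_mulEw (msuppD_le a b) (fsubset_refl (msupp c))).
rewrite (ga_mulEw (fsubsetUl _ (msupp b)) (fsubset_refl (msupp c))).
rewrite (ga_mulEw (fsubsetUr (msupp a) _) (fsubset_refl (msupp c))).
rewrite -big_split /=; apply/eq_bigr=> x _.
rewrite -big_split /=; apply/eq_bigr=> y _.
by rewrite mcoeffD mulrDl monalgUD.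
Qed.

Lemma ga_mulDr : right_distributive ga_mul +%R.
Proof.
move=> a b c; rewrite (ga_mulEw (fsubset_refl (msupp a)) (msuppD_le b c)).
rewrite (ga_mulEw (fsubset_refl (msupp a)) (fsubsetUl _ (msupp c))).
rewrite (ga_mulEw (fsubset_refl (msupp a)) (fsubsetUr (msupp b) _)).
rewrite -big_split /=; apply/eq_bigr=> x _.
rewrite -big_split /=; apply/eq_bigr=> y _.
by rewrite mcoeffD mulrDr monalgUD.
Qed.

Lemma ga_mul0 a : ga_mul a 0 = 0.
Proof. by apply: (addIr (ga_mul a 0)); rewrite -ga_mulDr !add0r. Qed.

Lemma ga_0mul a : ga_mul 0 a = 0.
Proof. by apply: (addIr (ga_mul 0 a)); rewrite -ga_mulDl !add0r. Qed.

Lemma ga_mulUU (r s : k) (x y : G) :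
  ga_mul << r *g x >> << s *g y >> = << r * s *g (x * y)%g >>.
Proof. by rewrite (ga_mulEw msuppU_le msuppU_le) !big_seq_fset1 !mcoeffUU. Qed.

Lemma ga_ind (P : group_alg -> Prop) :
  P 0 -> (forall a b, P a -> P b -> P (a + b)) ->
  (forall r x, P << r *g x >>) -> forall a, P a.
Proof.
by move=> P0 PD PU a; rewrite [a]monalgE; apply: big_ind => // x _; apply: PU.
Qed.

Lemma ga_mulA : associative ga_mul.
Proof.
move=> a b c; elim/ga_ind: a => [|a a' IH IH'|r x].
- by rewrite !ga_0mul.
- by rewrite !ga_mulDl IH IH'.
elim/ga_ind: b => [|b b' IH IH'|s y].
- by rewrite !(ga_0mul, ga_mul0).
- by rewrite !(ga_mulDl, ga_mulDr) IH IH'.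
elim/ga_ind: c => [|c c' IH IH'|t z].
- by rewrite !ga_mul0.
- by rewrite !ga_mulDr IH IH'.
by rewrite !ga_mulUU mulrA mulgA.
Qed.

Lemma ga_mul1l : left_id ga_one ga_mul.
Proof.
elim/ga_ind=> [|a b IH IH'|r x]; first by rewrite ga_mul0.
  by rewrite ga_mulDr IH IH'.
by rewrite ga_mulUU mul1r mul1g.
Qed.

Lemma ga_mul1r : right_id ga_one ga_mul.
Proof.
elim/ga_ind=> [|a b IH IH'|r x]; first by rewrite ga_0mul.
  by rewrite ga_mulDl IH IH'.
by rewrite ga_mulUU mulr1 mulg1.
Qed.

Lemma ga_one_neq0 : ga_one != 0.
Proof. by rewrite monalgU_eq0 oner_eq0. Qed.

HB.instance Definition _ := GRing.Zmodule_isNzRing.Build group_alg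
  ga_mulA ga_mul1l ga_mul1r ga_mulDl ga_mulDr ga_one_neq0.

Definition augmentation (a : group_alg) : k := \sum_(x <- msupp a) a@_x.

Lemma augmentationEw (d : {fset G}) a : (msupp a `<=` d)%fset ->
  augmentation a = \sum_(x <- d) a@_x.
Proof.
by move=> le_d; apply: big_fset_incl => // x _ /mcoeff_outdom.
Qed.

Lemma augmentation_is_zmod_morphism : zmod_morphism augmentation.
Proof.
move=> a b; rewrite (augmentationEw (msuppB_le a b)).
rewrite (augmentationEw (fsubsetUl _ (msupp b))).
rewrite (augmentationEw (fsubsetUr (msupp a) _)) -sumrB.
by apply: eq_bigr => x _; rewrite mcoeffB.
Qed.

HB.instance Definition _ :=
  GRing.isZmodMorphism.Build group_alg k augmentation
    augmentation_is_zmod_morphism.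

Lemma augmentationU (r : k) (x : G) : augmentation << r *g x >> = r.
Proof. by rewrite (augmentationEw msuppU_le) big_seq_fset1 mcoeffUU. Qed.

Lemma augmentation_is_monoid_morphism : monoid_morphism augmentation.
Proof.
split=> [|a b]; first exact: augmentationU.
elim/ga_ind: a => [|a a' IH IH'|r x].
- by rewrite !(mul0r, raddf0).
- by rewrite mulrDl !raddfD /= mulrDl IH IH'.
elim/ga_ind: b => [|b b' IH IH'|s y].
- by rewrite !(mulr0, raddf0).
- by rewrite mulrDr !raddfD /= mulrDr IH IH'.
by rewrite -[_ * _]/(ga_mul _ _) ga_mulUU !augmentationU.
Qed.

HB.instance Definition _ :=
  GRing.isMonoidMorphism.Build group_alg k augmentation
    augmentation_is_monoid_morphism.

(* k as a kG-module on which every element of G acts as the identity *)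
Definition trivial_module : Type := k.

HB.instance Definition _ := GRing.Zmodule.on trivial_module.

Definition triv_scale (a : group_alg) (c : trivial_module) : trivial_module :=
  augmentation a * (c : k).

Lemma triv_scaleA a b (c : trivial_module) :
  triv_scale a (triv_scale b c) = triv_scale (a * b) c.
Proof. by rewrite /triv_scale mulrA rmorphM. Qed.

Lemma triv_scale1 : left_id 1 triv_scale.
Proof. by move=> c; rewrite /triv_scale rmorph1 mul1r. Qed.

Lemma triv_scaleDr : right_distributive triv_scale +%R.
Proof. by move=> a x y; rewrite /triv_scale mulrDr. Qed.

Lemma triv_scaleDl (c : trivial_module) : {morph triv_scale^~ c : a b / a + b}.
Proof. by move=> a b; rewrite /triv_scale raddfD mulrDl. Qed.

HB.instance Definition _ :=
  GRing.Zmodule_isLmodule.Build group_alg trivial_module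
    triv_scaleA triv_scale1 triv_scaleDr triv_scaleDl.

Definition Ghd : option nat := Gfd (trivial_module : lmodType group_alg).
Definition Gcd : option nat := Gpd (trivial_module : lmodType group_alg).
Definition PGFcd : option nat := PGF_dim (trivial_module : lmodType group_alg).

End GroupAlgebra.

(* Main.v *)
From HB Require Import structures.
Require Import Defs.
From mathcomp Require Import all_boot all_order all_algebra.
From mathcomp Require Import finmap lra.
From mathcomp Require Import boolp classical_sets cardinality.
From mathcomp.multinomials Require Import monalg.

(** The group is G = Z^n x Q/Z.  Its group algebra R = kG is commutative; let
a_l = t_l - 1 for the generators t_0, ..., t_(n-1) of Z^n, let g_j be the class
of 1/(j+1)! in Q/Z, and put s_j = g_j - 1 and N_j = the sum of the powers of
g_j.  The cyclic groups generated by the g_j form a chain with union Q/Z, and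
there are c_j with s_j = c_j s_(j+1) and N_(j+1) = c_j N_j.

Upper bounds.  As R is free over the group algebra of the finite group
generated by g_j, the complex ... R -s_j-> R -N_j-> R -s_j-> ... is exact.  It
stays exact under I (x) - for I injective and under Hom(-, Q) for Q projective,
because both conditions compare annihilators and images of s_j and N_j on I and
on Q, and these are controlled by R: a Baer type extension argument for I
([exact_pair_injective]), a dual basis for Q ([exact_pair_projective]).  So
the direct sum X of the R/s_j R is PGF and Gorenstein projective
([periodic_tel]).  The maps (1, c_j) make these complexes a direct system; its
colimit alternates R with the flat module L = colim (R -c_0-> R -c_1-> ...), so
K = colim R/s_j R, which is k[Z^n], is Gorenstein flat ([periodic_colim_ker]).
The telescope is an exact sequence 0 -> X -> X -> K -> 0
([telescope_exact]).  Finally a_0, ..., a_(n-1) is a regular sequence on K with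
quotient k, and dividing by a regular central element lengthens a resolution by
one, by a mapping cone ([cone_resolution]).  Hence Ghd <= n, while Gcd and the
PGF dimension are at most n + 1.

Lower bounds.  Say that a module has depth n when a_0, ..., a_(n-1) behaves like
a regular sequence on it (the quotient may vanish).  Flat and projective
modules inherit depth n from R, and so does every module with an infinite
coresolution by modules of depth n ([coresolving_depth]); Gorenstein flat, PGF
and Gorenstein projective modules have such coresolutions.  Moreover, modulo
the a_l no nonzero element of R is killed by all s_j, since Q/Z is infinite, and
PGF and Gorenstein projective modules inherit this as submodules of projective
ones.  The element 1 of k is killed by all a_l and s_j.  Following it through
the connecting maps of a short resolution of k produces a nonzero class of the
same kind in the last term ([no_resolution]), which depth forbids in length
less than n for Gorenstein flat terms, and in length at most n for PGF and
Gorenstein projective ones.  In other words, Ext^i(k, -) over k[Z^n] vanishes on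
Gorenstein flat modules for i < n, and Ext^i(k, -) over kG vanishes on PGF and
Gorenstein projective modules for i <= n. *)

Set Implicit Arguments.
Unset Strict Implicit.
Unset Printing Implicit Defensive.

Import Order.TTheory GRing.Theory Num.Theory.
Local Open Scope ring_scope.
Local Open Scope quotient_scope.

(** * Submodules and quotient modules *)

Section Submodules.
Variables (R : pzRingType) (V : lmodType R).

(** Membership is a proposition rather than a boolean predicate, so that images
and kernels need no decision procedure. *)
Record submod := Submod {
  in_submod :> V -> Prop;
  submod0 : in_submod 0;
  submodD : forall x y, in_submod x -> in_submod y -> in_submod (x + y);
  submodZ : forall a x, in_submod x -> in_submod (a *: x) }.

Lemma submodN (S : submod) x : S x -> S (- x).
Proof. by move=> Sx; rewrite -scaleN1r; apply: submodZ. Qed.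

Lemma submodB (S : submod) x y : S x -> S y -> S (x - y).
Proof. by move=> Sx Sy; apply: submodD => //; apply: submodN. Qed.

Lemma submod_sum (S : submod) I (r : seq I) (P : pred I) (F : I -> V) :
  (forall i, P i -> S (F i)) -> S (\sum_(i <- r | P i) F i).
Proof. by move=> SF; elim/big_ind: _ => //; [apply: submod0 | apply: submodD]. Qed.

Definition submod_pred (S : submod) : {pred V} := fun x => `[< S x >].

Lemma submod_predP (S : submod) x : reflect (S x) (x \in submod_pred S).
Proof. exact: asboolP. Qed.

Fact submod_pred_closed (S : submod) : submod_closed (submod_pred S).
Proof.
split; first by apply/submod_predP/submod0.
move=> a x y /submod_predP Sx /submod_predP Sy; apply/submod_predP.
by apply: submodD => //; apply: submodZ.
Qed.

HB.instance Definition _ (S : submod) :=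
  GRing.isSubmodClosed.Build R V (submod_pred S) (submod_pred_closed S).

Record subm (S : submod) := Subm {subm_val :> V; _ : subm_val \in submod_pred S}.

HB.instance Definition _ S := [isSub for (@subm_val S)].
HB.instance Definition _ S := [Choice of subm S by <:].
HB.instance Definition _ S := [SubChoice_isSubLmodule of subm S by <:].

Definition quo (S : submod) := Quotient.quot (submod_pred S).
HB.instance Definition _ S := GRing.Zmodule.on (quo S).


Section Val.
Variable S : submod.

Fact subm_val_is_linear : linear (@subm_val S).
Proof. by []. Qed.
HB.instance Definition _ :=
  GRing.isLinear.Build R (subm S) V _ (@subm_val S) subm_val_is_linear.

Lemma subm_val_inj : injective (@subm_val S).
Proof. exact: val_inj. Qed.

Lemma subm_valP (x : subm S) : S (subm_val x).
Proof. by apply/submod_predP; case: x. Qed.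

Lemma submP x : S x -> exists y : subm S, subm_val y = x.
Proof. by move/submod_predP => Sx; exists (Subm Sx). Qed.

Section Corestriction.
Variables (U : lmodType R) (f : {linear U -> V}) (fS : forall u, S (f u)).

Definition cores (u : U) : subm S :=
  Subm (introT (submod_predP S (f u)) (fS u)).

Fact cores_is_linear : linear cores.
Proof. by move=> a x y; apply: subm_val_inj; rewrite /= linearP. Qed.
HB.instance Definition _ :=
  GRing.isLinear.Build R U (subm S) _ cores cores_is_linear.

End Corestriction.

Definition quo_pi (x : V) : quo S := \pi_(quo S) x.

Lemma quo_piE x y : (quo_pi x = quo_pi y) <-> S (x - y).
Proof.
split=> [/eqP|/submod_predP Sxy]; last first.
  by apply/eqP; rewrite /quo_pi -Quotient.idealrBE.
by rewrite /quo_pi -Quotient.idealrBE => /submod_predP.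
Qed.

Lemma quo_piK x : S (repr (quo_pi x) - x).
Proof. by apply/quo_piE; rewrite /quo_pi reprK. Qed.

Lemma quo_pi_repr (q : quo S) : quo_pi (repr q) = q.
Proof. exact: reprK. Qed.

Lemma quo_surj (q : quo S) : exists x, quo_pi x = q.
Proof. by exists (repr q); exact: quo_pi_repr. Qed.

Fact quo_pi_is_zmod_morphism : zmod_morphism quo_pi.
Proof. by move=> x y; rewrite /quo_pi raddfB. Qed.
HB.instance Definition _ :=
  GRing.isZmodMorphism.Build V (quo S) quo_pi quo_pi_is_zmod_morphism.

Definition quo_scale (a : R) (q : quo S) : quo S := quo_pi (a *: repr q).

Lemma quo_scale_pi a x : quo_scale a (quo_pi x) = quo_pi (a *: x).
Proof. by apply/quo_piE; rewrite -scalerBr; apply/submodZ/quo_piK. Qed.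

Fact quo_scaleA a b q : quo_scale a (quo_scale b q) = quo_scale (a * b) q.
Proof. by have [x <-] := quo_surj q; rewrite !quo_scale_pi scalerA. Qed.
Fact quo_scale1 : left_id 1 quo_scale.
Proof. by move=> q; have [x <-] := quo_surj q; rewrite quo_scale_pi scale1r. Qed.
Fact quo_scaleDr : right_distributive quo_scale +%R.
Proof.
move=> a q q'; have [x <-] := quo_surj q; have [y <-] := quo_surj q'.
by rewrite -raddfD !quo_scale_pi scalerDr raddfD.
Qed.
Fact quo_scaleDl q : {morph quo_scale^~ q : a b / a + b}.
Proof.
by move=> a b; have [x <-] := quo_surj q; rewrite !quo_scale_pi scalerDl raddfD.
Qed.
HB.instance Definition _ :=
  GRing.Zmodule_isLmodule.Build R (quo S)
    quo_scaleA quo_scale1 quo_scaleDr quo_scaleDl.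

Fact quo_pi_is_scalable : scalable quo_pi.
Proof. by move=> a x; rewrite -quo_scale_pi. Qed.
HB.instance Definition _ :=
  GRing.isScalable.Build R V (quo S) *:%R quo_pi quo_pi_is_scalable.

Lemma quo_pi_eq0 x : quo_pi x = 0 <-> S x.
Proof.
rewrite -[X in S X]subr0 -quo_piE linear0; exact: iff_refl.
Qed.

Section QuoLift.
Variables (W : lmodType R) (f : {linear V -> W}) (fS : forall x, S x -> f x = 0).

Definition quo_lift of (forall x, S x -> f x = 0) := fun q : quo S => f (repr q).

Lemma quo_lift_pi x : quo_lift fS (quo_pi x) = f x.
Proof. by apply/subr0_eq; rewrite /quo_lift -linearB; apply/fS/quo_piK. Qed.

Fact quo_lift_is_linear : linear (quo_lift fS).
Proof.
move=> a q q'; have [x <-] := quo_surj q; have [y <-] := quo_surj q'.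
by rewrite -linearP !quo_lift_pi linearP.
Qed.
HB.instance Definition _ :=
  GRing.isLinear.Build R (quo S) W _ (quo_lift fS) quo_lift_is_linear.

End QuoLift.
End Val.
End Submodules.

Section Kernels.
Variables (R : pzRingType) (V W : lmodType R) (f : {linear V -> W}).

Definition ker_submod : submod V.
Proof.
exists (fun x => f x = 0); first exact: linear0.
  by move=> x y fx fy; rewrite linearD fx fy addr0.
by move=> a x fx; rewrite linearZ /= fx scaler0.
Defined.

Definition im_submod : submod W.
Proof.
exists (fun y => exists x, f x = y); first by exists 0; apply: linear0.
  by move=> _ _ [x <-] [y <-]; exists (x + y); rewrite linearD.
by move=> a _ [x <-]; exists (a *: x); rewrite linearZ.
Defined.
End Kernels.

Definition zero_module (R : pzRingType) (M : lmodType R) := forall x : M, x = 0.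

(** The map of sets is a section of [p] followed by [f]; it is linear because
[f] does not see the choices made. *)
Lemma factor_through (R : pzRingType) (V W M : lmodType R)
    (p : {linear V -> M}) (f : {linear V -> W}) :
  (forall y, exists x, p x = y) -> (forall x, p x = 0 -> f x = 0) ->
  exists g : {linear M -> W}, forall x, g (p x) = f x.
Proof.
move=> p_surj pf.
have [s sP] := choice p_surj.
have gE x : f (s (p x)) = f x.
  by apply/subr0_eq; rewrite -linearB; apply: pf; rewrite linearB sP subrr.
have gl : linear (f \o s).
  by move=> a y z; rewrite /= -linearP -[RHS]gE [p _]linearP !sP.
pose g : {linear M -> W} := HB.pack (f \o s) (GRing.isLinear.Build R M W _ _ gl).
by exists g.
Qed.

(** * Tensor products *)

Section MalgExt.
Variables (S : comNzRingType) (K : choiceType) (W : lmodType S) (f : K -> W).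

(** With integer coefficients and [zmodule] this extends maps into any abelian
group, which is how additive maps out of tensor products are built. *)
Definition malg_ext (z : {malg S[K]}) : W := \sum_(x <- msupp z) z@_x *: f x.

Lemma malg_extEw (d : {fset K}) z : (msupp z `<=` d)%fset ->
  malg_ext z = \sum_(x <- d) z@_x *: f x.
Proof.
move=> le_d; rewrite /malg_ext (big_fset_incl _ le_d) // => x _ /mcoeff_outdom ->.
by rewrite scale0r.
Qed.

Fact malg_ext_is_linear : linear malg_ext.
Proof.
move=> a x y; pose d := (msupp x `|` msupp y)%fset.
have le_d : (msupp (a *: x + y) `<=` d)%fset.
  apply: fsubset_trans (msuppD_le _ _) _; apply: fsetSU; exact: msuppZ_le.
rewrite (malg_extEw le_d) (malg_extEw (fsubsetUl _ _ : msupp x `<=` d)%fset).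
rewrite (malg_extEw (fsubsetUr _ _ : msupp y `<=` d)%fset) scaler_sumr -big_split.
by apply: eq_bigr => i _; rewrite /= mcoeffD mcoeffZ scalerDl scalerA.
Qed.
HB.instance Definition _ :=
  GRing.isLinear.Build S {malg S[K]} W _ malg_ext malg_ext_is_linear.

Lemma malg_extU a x : malg_ext << a *g x >> = a *: f x.
Proof. by rewrite (malg_extEw msuppU_le) big_seq_fset1 mcoeffUU. Qed.
End MalgExt.

Lemma malg_ind (S : nzRingType) (K : choiceType) (P : {malg S[K]} -> Prop) :
  P 0 -> (forall a b, P a -> P b -> P (a + b)) ->
  (forall r x, P << r *g x >>) -> forall a, P a.
Proof.
by move=> P0 PD PU a; rewrite [a]monalgE; apply: big_ind => // x _; apply: PU.
Qed.

Section TensorTheory.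
Variables (R : pzRingType).
Implicit Types (A : lmodType R^c) (B : lmodType R).

Lemma tens_eq A B (y z : {malg int[(A * B)%type]}) :
  tensor_rel (y - z) <-> \pi_(tensor A B) y = \pi_(tensor A B) z.
Proof.
split=> [yz|/eqP].
  by apply/eqP; rewrite -Quotient.idealrBE; apply/asboolP.
by rewrite -Quotient.idealrBE => /asboolP.
Qed.

Lemma tens_eq0 A B (z : {malg int[(A * B)%type]}) :
  tensor_rel z <-> \pi_(tensor A B) z = 0.
Proof. by rewrite -[X in tensor_rel X]subr0 tens_eq raddf0. Qed.

Lemma tensDl A B (a a' : A) (b : B) : tens (a + a') b = tens a b + tens a' b.
Proof.
apply/subr0_eq; rewrite opprD addrA -!raddfB; apply/tens_eq0.
exact: TensorRelDl.
Qed.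

Lemma tensDr A B (a : A) (b b' : B) : tens a (b + b') = tens a b + tens a b'.
Proof.
apply/subr0_eq; rewrite opprD addrA -!raddfB; apply/tens_eq0.
exact: TensorRelDr.
Qed.

Lemma tensZ A B (a : A) (r : R) (b : B) :
  tens ((r : R^c) *: a) b = tens a (r *: b).
Proof. by apply/subr0_eq; rewrite -raddfB; apply/tens_eq0/TensorRelZ. Qed.

Lemma tens0r A B (a : A) : tens a (0 : B) = 0.
Proof. by apply: (addIr (tens a (0 : B))); rewrite -tensDr !add0r. Qed.

Lemma tens0l A B (b : B) : tens (0 : A) b = 0.
Proof. by apply: (addIr (tens (0 : A) b)); rewrite -tensDl !add0r. Qed.

Lemma tensNl A B (a : A) (b : B) : tens (- a) b = - tens a b.
Proof. by apply/eqP; rewrite -addr_eq0 -tensDl addNr tens0l. Qed.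

Lemma tens_sumr A B I (r : seq I) (a : A) (F : I -> B) :
  tens a (\sum_(i <- r) F i) = \sum_(i <- r) tens a (F i).
Proof. by elim/big_rec2: _ => [|i x y _ <-]; rewrite ?tens0r ?tensDr. Qed.

Lemma tensor_ind A B (P : tensor A B -> Prop) :
  (forall y z, P y -> P z -> P (y + z)) -> (forall a b, P (tens a b)) ->
  forall z, P z.
Proof.
move=> PD PT.
have P0 : P 0 by rewrite -(tens0l A (0 : B)).
have PM z m : P z -> P (z *+ m).
  by move=> Pz; elim: m => [//|m IH]; rewrite mulrS; apply: PD.
move=> z; rewrite -[z]reprK; elim/malg_ind: (repr z) => [|x y Px Py|r [a b]].
- by rewrite raddf0.
- by rewrite raddfD; apply: PD.
case: r => m.
  suff -> : \pi_(tensor A B) << (m : int) *g (a, b) >> = tens a b *+ m by apply: PM.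
  by rewrite /tens -raddfMn -monalgUMn /= natz.
suff -> : \pi_(tensor A B) << Negz m *g (a, b) >> = tens (- a) b *+ m.+1.
  exact: PM.
by rewrite tensNl mulNrn /tens -raddfMn -monalgUMn -raddfN -monalgUN /= natz NegzE.
Qed.

Section Universal.
Variables (A : lmodType R^c) (B : lmodType R) (W : zmodType) (f : A -> B -> W).
Hypothesis fDl : forall a a' b, f (a + a') b = f a b + f a' b.
Hypothesis fDr : forall a b b', f a (b + b') = f a b + f a b'.
Hypothesis fZ : forall a (r : R) b, f ((r : R^c) *: a) b = f a (r *: b).

(** The universal property of the tensor product.  It serves to detect nonzero
tensors. *)
Lemma tensor_lift : exists F : {additive tensor A B -> W},
  forall a b, F (tens a b) = f a b.
Proof.
pose F0 : {linear {malg int[(A * B)%type]} -> zmodule W} :=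
  malg_ext (fun p : A * B => (f p.1 p.2 : zmodule W)).
have F0U p : F0 << p >> = f p.1 p.2 by rewrite /F0 /= malg_extU scale1r.
have relF z : tensor_rel z -> F0 z = 0.
  elim=> [|x y _ hx _ hy|a a' b|a b b'|a r b].
  - exact: linear0.
  - by rewrite linearB hx hy subrr.
  - by rewrite !linearB !F0U /= fDl -addrA -opprD subrr.
  - by rewrite !linearB !F0U /= fDr -addrA -opprD subrr.
  - by rewrite linearB !F0U /= fZ subrr.
pose F1 (z : tensor A B) : W := F0 (repr z).
have F1E z : F1 (\pi_(tensor A B) z) = F0 z.
  apply/subr0_eq; rewrite /F1 -[LHS](linearB F0); apply/relF/tens_eq.
  by rewrite reprK.
have F1B : zmod_morphism F1.
  by move=> x y; rewrite -[x]reprK -[y]reprK -raddfB !F1E; apply: linearB.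
pose F : {additive tensor A B -> W} :=
  HB.pack F1 (GRing.isZmodMorphism.Build _ _ _ F1B).
by exists F => a b; rewrite /= /tens F1E F0U.
Qed.
End Universal.

Lemma tensor_map_comp A A' A'' B B' B'' (f : {linear A -> A'})
    (f' : {linear A' -> A''}) (g : {linear B -> B'}) (g' : {linear B' -> B''})
    (f2 : {linear A -> A''}) (g2 : {linear B -> B''}) z :
  (forall x, f' (f x) = f2 x) -> (forall x, g' (g x) = g2 x) ->
  tensor_map f' g' (tensor_map f g z) = tensor_map f2 g2 z.
Proof.
move=> ff gg; elim/tensor_ind: z => [x y IHx IHy|a b].
  by rewrite !raddfD /= IHx IHy.
by rewrite !tensor_mapE ff gg.
Qed.

Lemma tensor_map0 A A' B B' (f : {linear A -> A'}) (g : {linear B -> B'}) z :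
  (forall x, g x = 0) -> tensor_map f g z = 0.
Proof.
move=> g0; elim/tensor_ind: z => [x y IHx IHy|a b].
  by rewrite !raddfD /= IHx IHy addr0.
by rewrite !tensor_mapE g0 tens0r.
Qed.

End TensorTheory.

(** * Gorenstein modules from 2-periodic complexes *)

Lemma exact_atI (U V W : zmodType) (f : U -> V) (g : V -> W) :
  (forall x, g (f x) = 0) -> (forall y, g y = 0 -> exists x, f x = y) ->
  exact_at f g.
Proof. by move=> gf fg y; split=> [/fg|[x <-]]. Qed.

Lemma exact_comp0 (U V W : zmodType) (f : U -> V) (g : V -> W) x :
  exact_at f g -> g (f x) = 0.
Proof. by move=> fg; apply/fg; exists x. Qed.

Section Products.
Variable R : pzRingType.
Implicit Types (A B C M N P Q : lmodType R) (I : lmodType R^c).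

Definition inj1 A B (x : A) : (A * B)%type := (x, 0).
Definition inj2 A B (x : B) : (A * B)%type := (0, x).
Definition prod_map A A' B B' (f : A -> B) (f' : A' -> B') (x : A * A') :=
  (f x.1, f' x.2).

Fact inj1_is_linear A B : linear (@inj1 A B).
Proof. by move=> a x y; congr (_, _) => /=; rewrite scaler0 addr0. Qed.
HB.instance Definition _ A B :=
  GRing.isLinear.Build R A (A * B)%type _ (@inj1 A B) (@inj1_is_linear A B).
Fact inj2_is_linear A B : linear (@inj2 A B).
Proof. by move=> a x y; congr (_, _) => /=; rewrite scaler0 addr0. Qed.
HB.instance Definition _ A B :=
  GRing.isLinear.Build R B (A * B)%type _ (@inj2 A B) (@inj2_is_linear A B).
Fact prod_map_is_linear A A' B B' (f : {linear A -> B}) (f' : {linear A' -> B'}) :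
  linear (prod_map f f').
Proof. by move=> a x y; congr (_, _); rewrite /= linearP. Qed.
HB.instance Definition _ A A' B B' (f : {linear A -> B}) (f' : {linear A' -> B'}) :=
  GRing.isLinear.Build R (A * A')%type (B * B')%type _ (@prod_map A A' B B' f f')
   (@prod_map_is_linear A A' B B' f f').

(** This splitting reduces exactness for a product to its two factors. *)
Lemma tensor_prod_split I A B (z : tensor I (A * B)%type) :
  z = tensor_map (@idfun I) (@inj1 A B) (tensor_map (@idfun I) (@fst A B) z) +
      tensor_map (@idfun I) (@inj2 A B) (tensor_map (@idfun I) (@snd A B) z).
Proof.
elim/tensor_ind: z => [x y IHx IHy|a [b b']].
  by rewrite !raddfD /= {1}IHx {1}IHy addrACA.
rewrite !tensor_mapE /= -tensDr; congr tens.
by congr (_, _); rewrite ?addr0 ?add0r.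
Qed.


Lemma tensor_exact_prod I A A' B B' C C' (f : {linear A -> B}) (g : {linear B -> C})
    (f' : {linear A' -> B'}) (g' : {linear B' -> C'}) :
  exact_at (tensor_map (@idfun I) f) (tensor_map (@idfun I) g) ->
  exact_at (tensor_map (@idfun I) f') (tensor_map (@idfun I) g') ->
  exact_at (tensor_map (@idfun I) (prod_map f f'))
           (tensor_map (@idfun I) (prod_map g g')).
Proof.
have swap M N P Q (h1 : {linear M -> N}) (h2 : {linear N -> Q})
    (h3 : {linear M -> P}) (h4 : {linear P -> Q}) (z : tensor I M) :
  (forall x, h2 (h1 x) = h4 (h3 x)) ->
  tensor_map (@idfun I) h2 (tensor_map (@idfun I) h1 z) =
  tensor_map (@idfun I) h4 (tensor_map (@idfun I) h3 z).
  move=> h; rewrite (tensor_map_comp (f2 := @idfun I) (g2 := h4 \o h3)) //.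
  by rewrite (tensor_map_comp (f2 := @idfun I) (g2 := h4 \o h3)).
move=> fg fg'; apply: exact_atI => [z|z gz].
  rewrite [LHS]tensor_prod_split.
  rewrite (swap _ _ _ _ _ (@fst C C') (@fst B B') g) //.
  rewrite (swap _ _ _ _ _ (@fst B B') (@fst A A') f) // (exact_comp0 _ fg) raddf0.
  rewrite (swap _ _ _ _ _ (@snd C C') (@snd B B') g') //.
  rewrite (swap _ _ _ _ _ (@snd B B') (@snd A A') f') // (exact_comp0 _ fg') raddf0.
  by rewrite addr0.
have /fg[x xE] : tensor_map (@idfun I) g (tensor_map (@idfun I) (@fst B B') z) = 0.
  by rewrite -(swap _ _ _ _ (prod_map g g') (@fst C C')) // gz raddf0.
have /fg'[y yE] : tensor_map (@idfun I) g' (tensor_map (@idfun I) (@snd B B') z) = 0.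
  by rewrite -(swap _ _ _ _ (prod_map g g') (@snd C C')) // gz raddf0.
exists (tensor_map (@idfun I) (@inj1 A A') x + tensor_map (@idfun I) (@inj2 A A') y).
rewrite raddfD /= (swap _ _ _ _ _ _ f (@inj1 B B')) => [|a]; last first.
  by congr (_, _); rewrite /= linear0.
rewrite (swap _ _ _ _ (@inj2 A A') _ f' (@inj2 B B')) => [|a]; last first.
  by congr (_, _); rewrite /= linear0.
by rewrite xE yE -tensor_prod_split.
Qed.

Lemma exact_prod A A' B B' C C' (f : {linear A -> B}) (g : {linear B -> C})
    (f' : {linear A' -> B'}) (g' : {linear B' -> C'}) :
  exact_at f g -> exact_at f' g' -> exact_at (prod_map f f') (prod_map g g').
Proof.
move=> fg fg'; apply: exact_atI => [[x x']|[y y'] [/fg[x <-] /fg'[x' <-]]].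
  by congr (_, _); [apply: exact_comp0 fg|apply: exact_comp0 fg'].
by exists (x, x').
Qed.

Lemma flat_prod A B :
  flat_module A -> flat_module B -> flat_module (A * B)%type.
Proof.
move=> flA flB M N P f g fg.
have swap (L L' : lmodType R^c) (h : {linear L -> L'}) (X Y : lmodType R)
    (k : {linear X -> Y}) z :
    tensor_map (@idfun L') k (tensor_map h (@idfun X) z) =
    tensor_map h (@idfun Y) (tensor_map (@idfun L) k z).
  by rewrite !(tensor_map_comp (f2 := h) (g2 := k)).
apply: exact_atI => [z|z gz].
  rewrite (tensor_map_comp (f2 := \0) (g2 := @idfun (A * B)%type)) //.
    elim/tensor_ind: z => [y z|a b]; last by rewrite tensor_mapE tens0l.
    by rewrite raddfD /= => -> ->; rewrite addr0.
  by move=> x; apply: exact_comp0 fg.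
have /(flA _ _ _ _ _ fg)[x xE] :
    tensor_map g (@idfun A) (tensor_map (@idfun N) (@fst A B) z) = 0.
  by rewrite -swap gz raddf0.
have /(flB _ _ _ _ _ fg)[y yE] :
    tensor_map g (@idfun B) (tensor_map (@idfun N) (@snd A B) z) = 0.
  by rewrite -swap gz raddf0.
exists (tensor_map (@idfun M) (@inj1 A B) x + tensor_map (@idfun M) (@inj2 A B) y).
by rewrite raddfD /= -!swap xE yE -tensor_prod_split.
Qed.

Lemma projective_prod A B :
  projective_module A -> projective_module B -> projective_module (A * B)%type.
Proof.
move=> prA prB M N p f p_surj.
have [f1 f1E] := prA M N p (f \o @inj1 A B) p_surj.
have [f2 f2E] := prB M N p (f \o @inj2 A B) p_surj.
exists ((f1 \o @fst A B) \+ (f2 \o @snd A B)) => -[a b].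
rewrite /= linearD f1E f2E /= -linearD; congr (f (_, _)); by rewrite ?addr0 ?add0r.
Qed.

End Products.

Section Periodic.
Variable R : pzRingType.

Section Complex.
Variables (A B : lmodType R) (u : {linear A -> B}) (v : {linear B -> A}).

Definition per_obj (b : bool) : lmodType R := if b then A else B.
(** The two diagonal cases never occur as differentials; they are there so that
the differential is a function of the parities of its source and target, without
transport along the equation between the parities of i and i + 1. *)
Definition per_map (b b' : bool) : {linear per_obj b -> per_obj b'} :=
  match b, b' with
  | true, false => u
  | false, true => v
  | true, true => \0
  | false, false => \0
  end.
Definition par (i : int) : bool := odd `|i|%N.

Lemma par_succ i : par (i + 1) = ~~ par i.
Proof.
rewrite /par; case: i => m; first by rewrite -PoszD addn1.
case: m => [//|m].
have -> : (Negz m.+1 + 1 = Negz m)%R by rewrite !NegzE -addn1 PoszD opprD addrK.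
by rewrite !NegzE !abszN /= negbK.
Qed.

Hypotheses (uv : forall x, u (v x) = 0) (vu : forall x, v (u x) = 0).

Fact per_diff_diff i x : per_map (par (i + 1)) (par i)
  (per_map (par (i + 1 + 1)) (par (i + 1)) x) = 0.
Proof.
move: x; rewrite !par_succ; case: (par i) => x /=; [exact: vu | exact: uv].
Qed.

Definition per_complex : complex R :=
  Complex (obj := fun i => per_obj (par i)) per_diff_diff.

(** A property of pairs of composable maps needs to be checked for the two pairs
of one period only. *)
Lemma per_complexP (P : forall X Y Z : lmodType R,
    {linear X -> Y} -> {linear Y -> Z} -> Prop) :
  P _ _ _ u v -> P _ _ _ v u ->
  forall i, P _ _ _ (diff per_complex (i + 1)) (diff per_complex i).
Proof.
move=> Puv Pvu i; rewrite /per_complex /diff /=.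
by rewrite !par_succ; case: (par i).
Qed.

End Complex.

Definition pair_cond :=
  forall X Y Z : lmodType R, {linear X -> Y} -> {linear Y -> Z} -> Prop.

(** A common shape for the three Gorenstein classes: the terms lie in [C], and
[T] is the exactness required of consecutive differentials after applying
tensor or Hom functors.  As all these complexes have the same period, their
cycles can be added without shifting degrees. *)
Definition periodic (C : lmodType R -> Prop) (T : pair_cond) (M : lmodType R) :=
  exists (A B : lmodType R) (u : {linear A -> B}) (v : {linear B -> A}),
    [/\ C A /\ C B, exact_at u v /\ exact_at v u, T _ _ _ u v, T _ _ _ v u &
        exists j : {linear M -> A}, injective j /\ exact_at j u].

Definition inj_tensor_exact : pair_cond := fun X Y Z f g =>
  forall I : lmodType R^c, injective_module I ->
  exact_at (tensor_map (@idfun I) f) (tensor_map (@idfun I) g).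

Definition proj_hom_exact : pair_cond := fun X Y Z f g =>
  forall Q : lmodType R, projective_module Q ->
  forall w : {linear Y -> Q}, (forall x, w (f x) = 0) <->
    exists v : {linear Z -> Q}, forall x, v (g x) = w x.

Definition proj_total : pair_cond := fun X Y Z f g =>
  inj_tensor_exact f g /\ proj_hom_exact f g.

Lemma periodic_complex C (T : pair_cond) M : periodic C T M ->
  exists F : complex R, [/\ forall i, C (F i), acyclic F,
    forall i, T _ _ _ (diff F (i + 1)) (diff F i) & is_cycle_of M F].
Proof.
move=> [A [B [u [v [[CA CB] [uv vu] Tuv Tvu [j [j_inj ju]]]]]]].
exists (per_complex (fun x => exact_comp0 x vu) (fun x => exact_comp0 x uv)).
split.
- by move=> i; rewrite /=; case: (par i).
- exact: (per_complexP _ _ (P := fun (X Y Z : lmodType R)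
    (f : {linear X -> Y}) (g : {linear Y -> Z}) => exact_at f g)).
- exact: per_complexP.
- by exists 0, j.
Qed.

Lemma periodic_GF M : periodic (@flat_module R) inj_tensor_exact M ->
  gorenstein_flat M.
Proof.
move=> /periodic_complex[F [flF acF TF cycF]]; exists F; split=> // I injI i.
exact: TF.
Qed.

Lemma periodic_PGF M : periodic (@projective_module R) proj_total M -> PGF M.
Proof.
move=> /periodic_complex[F [flF acF TF cycF]]; exists F; split=> // I injI i.
by have [TFi _] := TF i; apply: TFi.
Qed.

Lemma periodic_GP M :
  periodic (@projective_module R) proj_total M -> gorenstein_projective M.
Proof.
move=> /periodic_complex[F [flF acF TF cycF]]; exists F; split=> // Q prQ i.
by have [_ TFi] := TF i; apply: TFi.
Qed.

Definition prod_closed_cond (T : pair_cond) :=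
  forall (A A' B B' D D' : lmodType R) (f : {linear A -> B}) (g : {linear B -> D})
    (f' : {linear A' -> B'}) (g' : {linear B' -> D'}),
  T _ _ _ f g -> T _ _ _ f' g' -> T _ _ _ (prod_map f f') (prod_map g g').

Lemma inj_tensor_exact_prod : prod_closed_cond inj_tensor_exact.
Proof.
move=> A A' B B' D D' f g f' g' Tf Tf' I injI.
by apply: tensor_exact_prod; [apply: Tf | apply: Tf'].
Qed.

Lemma proj_total_prod : prod_closed_cond proj_total.
Proof.
move=> A A' B B' D D' f g f' g' [Tf Hf] [Tf' Hf'].
split=> [|Q prQ w]; first exact: inj_tensor_exact_prod.
split=> [wf|[v vw] x].
  have [|v vE] := (Hf Q prQ (w \o @inj1 _ B B')).1.
    move=> x /=; rewrite -[RHS](wf (x, 0)); congr (w (_, _)).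
    by rewrite /= linear0.
  have [|v' vE'] := (Hf' Q prQ (w \o @inj2 _ B B')).1.
    move=> x /=; rewrite -[RHS](wf (0, x)); congr (w (_, _)).
    by rewrite /= linear0.
  exists ((v \o @fst D D') \+ (v' \o @snd D D')) => -[x x'].
  by rewrite /= vE vE' /= -linearD; congr (w (_, _)); rewrite ?addr0 ?add0r.
rewrite -vw; have <- : (v \o @inj1 _ D D') (g (f x.1)) + (v \o @inj2 _ D D') (g' (f' x.2))
   = v (prod_map g g' (prod_map f f' x)).
  by rewrite /= -linearD; congr (v (_, _)); rewrite /= ?addr0 ?add0r.
rewrite -[X in X + _]/((v \o @inj1 _ D D' \o g) (f x.1)).
rewrite -[X in _ + X]/((v \o @inj2 _ D D' \o g') (f' x.2)).
rewrite (Hf Q prQ (v \o @inj1 _ D D' \o g)).2; last by exists (v \o @inj1 _ D D').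
by rewrite (Hf' Q prQ (v \o @inj2 _ D D' \o g')).2 ?addr0 //; exists (v \o @inj2 _ D D').
Qed.

Lemma periodic_prod (C : lmodType R -> Prop) (T : pair_cond) M M' :
  (forall A B, C A -> C B -> C (A * B)%type) -> prod_closed_cond T ->
  periodic C T M -> periodic C T M' -> periodic C T (M * M')%type.
Proof.
move=> CP TP [A [B [u [v [[CA CB] [uv vu] Tuv Tvu [j [j_inj ju]]]]]]].
move=> [A' [B' [u' [v' [[CA' CB'] [uv' vu'] Tuv' Tvu' [j' [j_inj' ju']]]]]]].
exists (A * A')%type, (B * B')%type, (prod_map u u'), (prod_map v v').
split; [by split; apply: CP | by split; apply: exact_prod | exact: TP | exact: TP |].
exists (prod_map j j'); split; last exact: exact_prod.
by move=> [x x'] [y y'] [/j_inj-> /j_inj'->].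
Qed.

Lemma periodic_zero (C : lmodType R -> Prop) (T : pair_cond) M :
  (forall Z, zero_module Z -> C Z) ->
  (forall (X Y Z : lmodType R) (f : {linear X -> Y}) (g : {linear Y -> Z}),
     zero_module Y -> T _ _ _ f g) ->
  zero_module M -> periodic C T M.
Proof.
move=> CZ TZ M0; have ex (X Z : lmodType R) (f : {linear X -> M}) (g : {linear M -> Z}) :
  exact_at f g.
  by move=> y; split=> [_|_]; [exists 0; rewrite linear0 (M0 y)|rewrite (M0 y) linear0].
exists M, M, \0, \0; split; [by split; apply: CZ | by split | exact: TZ | exact: TZ |].
by exists idfun; split.
Qed.

Lemma tensor_zero (I : lmodType R^c) (Z : lmodType R) (z : tensor I Z) :
  zero_module Z -> z = 0.
Proof.
move=> Z0; elim/tensor_ind: z => [x y -> ->|a b]; first by rewrite addr0.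
by rewrite (Z0 b) tens0r.
Qed.

Lemma flat_zero (Z : lmodType R) : zero_module Z -> flat_module Z.
Proof.
move=> Z0 A B C f g _ y; rewrite (tensor_zero y Z0).
by split=> _; rewrite ?raddf0 //; exists 0; rewrite raddf0.
Qed.

Lemma projective_zero (Z : lmodType R) : zero_module Z -> projective_module Z.
Proof. by move=> Z0 A B p f _; exists \0 => x; rewrite (Z0 x) !linear0. Qed.

Lemma inj_tensor_exact_zero (X Y Z : lmodType R) (f : {linear X -> Y})
    (g : {linear Y -> Z}) :
  zero_module Y -> inj_tensor_exact f g.
Proof.
move=> Y0 I _ y; rewrite (tensor_zero y Y0).
by split=> _; rewrite ?raddf0 //; exists 0; rewrite raddf0.
Qed.

Lemma proj_total_zero (X Y Z : lmodType R) (f : {linear X -> Y})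
    (g : {linear Y -> Z}) :
  zero_module Y -> proj_total f g.
Proof.
move=> Y0; split=> [|Q _ w]; first exact: inj_tensor_exact_zero.
have w0 y : w y = 0 by rewrite (Y0 y) linear0.
by split=> [_|_ x]; last exact: w0; exists \0 => x; rewrite w0.
Qed.

End Periodic.

(** * Resolutions *)

Section Resolutions.
Variable R : pzRingType.
Implicit Types (M N X : lmodType R) (C : lmodType R -> Prop).

Lemma resolution_dim_eq C M n :
  has_resolution C M n -> (forall m, (m < n)%N -> ~ has_resolution C M m) ->
  resolution_dim C M = Some n.
Proof.
move=> resn minn; rewrite /resolution_dim /inf_nat.
case: pselect => [exP|[]]; last by exists n; apply/asboolP.
case: ex_minnP => m /asboolP resm le_m; congr Some; apply/eqP.
rewrite eqn_leq le_m ?andTb; last exact/asboolP.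
by rewrite leqNgt; apply/negP => /minn.
Qed.

Lemma has_resolution0 C M : C M -> has_resolution C M 0.
Proof.
move=> CM; pose X i : lmodType R := if i is 0%N then M else 'rV[R]_0.
have X0 i (x : X i.+1) : x = 0 by exact: thinmx0.
exists X, (fun i => \0), idfun; split.
- by case.
- by case.
- by move=> m; exists m.
- by move=> y; split=> [y0|[x <-]] //; exists 0; apply/esym/y0.
- by move=> i y; split=> // _; exists 0; rewrite (X0 _ y).
Qed.

Lemma has_resolution_bij C M N (f : {linear M -> N}) n : bijective f ->
  has_resolution C M n -> has_resolution C N n.
Proof.
move=> f_bij [X [d [e [CX X0 e_surj de dd]]]].
exists X, d, (f \o e); split=> // [y|y].
  have [g fK gK] := f_bij.
  by have [x xE] := e_surj (g y); exists x; rewrite /= xE gK.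
split=> [|/de ey /=]; last by rewrite ey linear0.
by move=> /= fe0; apply/de/(bij_inj f_bij); rewrite fe0 linear0.
Qed.

Definition short_exact N X M (i : {linear N -> X}) (q : {linear X -> M}) :=
  [/\ injective i, exact_at i q & forall m, exists x, q x = m].

Lemma has_resolutionS C N X M (i : {linear N -> X}) (q : {linear X -> M}) n :
  short_exact i q -> C X -> has_resolution C N n -> has_resolution C M n.+1.
Proof.
move=> [i_inj iq q_surj] CX [Y [d [e [CY Y0 e_surj de dd]]]].
pose Z j : lmodType R := if j is j'.+1 then Y j' else X.
pose dZ j : {linear Z j.+1 -> Z j} :=
  match j return {linear Z j.+1 -> Z j} with
  | 0%N => i \o e | j'.+1 => d j' end.
exists Z, dZ, q; split=> //.
- by case=> // j; rewrite ltnS; apply: CY.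
- by case=> // j; rewrite ltnS; apply: Y0.
- move=> y; rewrite iq /=; split=> [[x <-]|[x <-]]; last by exists (e x).
  by have [z <-] := e_surj x; exists z.
- case=> [|j] y /=; last exact: dd.
  by rewrite -de; split=> [ie0|->]; [apply: i_inj; rewrite ie0|]; rewrite linear0.
Qed.

Lemma has_resolution0_inv C M : has_resolution C M 0 ->
  exists X (f : {linear X -> M}), C X /\ bijective f.
Proof.
move=> [X [d [e [CX X0 e_surj de dd]]]].
exists (X 0%N), e; split; first exact: CX.
have [g gK] := choice e_surj.
have e_inj : injective e.
  move=> x y exy; apply/subr0_eq.
  have /de[z <-] : e (x - y) = 0 by rewrite linearB exy subrr.
  by rewrite (X0 1%N isT z) linear0.
by exists g => // x; apply: e_inj; rewrite gK.
Qed.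

(** The first syzygy N is the kernel of the augmentation; this is what makes
induction on the length of a resolution possible. *)
Lemma has_resolutionS_inv C M n : has_resolution C M n.+1 ->
  exists N X (i : {linear N -> X}) (q : {linear X -> M}),
    [/\ short_exact i q, C X & has_resolution C N n].
Proof.
move=> [X [d [e [CX X0 e_surj de dd]]]].
pose K := ker_submod e.
have dK x : K (d 0%N x) by apply/de; exists x.
exists (subm K), (X 0%N), (@subm_val _ _ K), e; split; [split=> // | exact: CX |].
- exact: subm_val_inj.
- move=> y; split=> [ey0|[x <-]]; [exact: (@submP _ _ K) | exact: (subm_valP x)].
exists (fun j => X j.+1), (fun j => d j.+1), (cores dK); split=> //.
- by move=> j lej; apply: CX.
- by move=> j ltj; apply: X0.
- move=> k; have /de[x xE] := subm_valP k.
  by exists x; apply: subm_val_inj.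
- move=> y; rewrite -dd; split=> [/(congr1 (@subm_val _ _ K))|dy] //.
  by apply: subm_val_inj.
Qed.

End Resolutions.

Section Cone.
Variables (R : comNzRingType) (a : R).
Implicit Types (M N X : lmodType R).

Definition hom_scale M (x : M) := a *: x.
Fact hom_scale_is_linear M : linear (@hom_scale M).
Proof. by move=> b x y; rewrite /hom_scale scalerDr !scalerA mulrC. Qed.
HB.instance Definition _ M :=
  GRing.isLinear.Build R M M _ (@hom_scale M) (@hom_scale_is_linear M).

Section ConeMaps.
Variables (X2 X1 X0 : lmodType R) (d1 : {linear X2 -> X1}) (d0 : {linear X1 -> X0}).

Definition cone0 (x : X1 * X0) : X0 := d0 x.1 + a *: x.2.
Fact cone0_is_linear : linear cone0.
Proof.
move=> b x y; rewrite /cone0 /= linearP !scalerDr !scalerA addrACA.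
by rewrite mulrC.
Qed.
HB.instance Definition _ :=
  GRing.isLinear.Build R (X1 * X0)%type X0 _ cone0 cone0_is_linear.

Definition coneS (x : X2 * X1) : (X1 * X0)%type := (d1 x.1 + a *: x.2, - d0 x.2).
Fact coneS_is_linear : linear coneS.
Proof.
move=> b x y; congr (_, _); rewrite /= linearP ?opprD ?scalerN //.
by rewrite !scalerDr !scalerA addrACA mulrC.
Qed.
HB.instance Definition _ :=
  GRing.isLinear.Build R (X2 * X1)%type (X1 * X0)%type _ coneS coneS_is_linear.
End ConeMaps.

(** Multiplication by [a] on M lifts to multiplication by [a] on the whole
resolution, since [a] acts linearly on every module; the mapping cone of this
chain map resolves M / a M.  The signs are put on the second component, so that
one formula serves in all degrees. *)
Lemma cone_resolution (C : lmodType R -> Prop) M M' (q : {linear M -> M'}) n :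
  (forall X Y, C X -> C Y -> C (X * Y)%type) ->
  (forall X, zero_module X -> C X) ->
  short_exact (@hom_scale M) q ->
  has_resolution C M n -> has_resolution C M' n.+1.
Proof.
move=> CP CZ [a_inj aq q_surj] [X [d [e [CX X0 e_surj de dd]]]].
have CX' i : C (X i).
  by case: (leqP i n) => [/CX //|lti]; apply: CZ; apply: X0.
pose Y i : lmodType R := if i is j.+1 then (X j.+1 * X j)%type else X 0%N.
pose D i : {linear Y i.+1 -> Y i} :=
  match i return {linear Y i.+1 -> Y i} with
  | 0%N => cone0 (d 0%N) | j.+1 => coneS (d j.+1) (d j) end.
exists Y, D, (q \o e); split.
- by case=> [|i] _; [apply: CX'|apply: CP; apply: CX'].
- case=> // i; rewrite ltnS => lti [x y].
  by rewrite (X0 _ (leqW lti) x) (X0 _ lti y).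
- by move=> m'; have [m <-] := q_surj m'; have [x <-] := e_surj m; exists x.
- apply: exact_atI => [[x1 x0]|x0 /= /aq[m mE]].
    rewrite /= /cone0 /= linearD linearZ /= (exact_comp0 _ de) add0r.
    exact: (exact_comp0 _ aq).
  have [y yE] := e_surj m.
  have /de[x1 x1E] : e (x0 - a *: y) = 0.
    by rewrite linearB linearZ /= yE -mE subrr.
  by exists (x1, y); rewrite /= /cone0 /= x1E subrK.
case=> [|i]; apply: exact_atI.
- move=> [x2 x1]; rewrite /= /cone0 /coneS /= linearD linearZ /= (exact_comp0 _ (dd _)).
  by rewrite add0r scalerN subrr.
- move=> [x1 x0]; rewrite /= /cone0 /= => dx.
  have : e x0 = 0.
    apply: a_inj; rewrite /= /hom_scale scaler0 -linearZ /=.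
    have -> : a *: x0 = - d 0%N x1 by apply/eqP; rewrite -addr_eq0 addrC dx.
    by rewrite linearN (exact_comp0 _ de) oppr0.
  move=> /de[y yE].
  have /dd[x2 x2E] : d 0%N (x1 + a *: y) = 0 by rewrite linearD linearZ /= yE.
  by exists (x2, - y); rewrite /coneS /= x2E scalerN addrK linearN opprK yE.
- move=> [x2 x1]; rewrite /= /coneS /=; congr (_, _).
    by rewrite linearD linearZ /= (exact_comp0 _ (dd _)) add0r scalerN subrr.
  by rewrite linearN opprK (exact_comp0 _ (dd _)).
move=> [x1 x0]; rewrite /= /coneS /= => -[dx /eqP]; rewrite oppr_eq0 => /eqP/dd[y yE].
have /dd[x2 x2E] : d i.+1 (x1 + a *: y) = 0 by rewrite linearD linearZ /= yE.
by exists (x2, - y); rewrite /coneS /= x2E scalerN addrK linearN opprK yE.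
Qed.

End Cone.

(** * Depth *)

Section Depth.
Variables (R : comNzRingType) (a : nat -> R).
Implicit Types (M N X V W : lmodType R).

(** The elements of the submodule a_0 V + ... + a_(l-1) V.  The recursion
removes the last multiple first, as the induction on regular sequences
does. *)
Fixpoint mults V l (x : V) : Prop :=
  if l is l'.+1 then exists y, mults l' (x - a l' *: y) else x = 0.

Lemma mults0 V l : mults l (0 : V).
Proof. by elim: l => //= l IH; exists 0; rewrite scaler0 subr0. Qed.

Lemma multsD V l (x y : V) : mults l x -> mults l y -> mults l (x + y).
Proof.
elim: l x y => [|l IH] x y /=; first by move=> -> ->; rewrite addr0.
move=> [u xu] [v yv]; exists (u + v).
by rewrite scalerDr opprD addrACA; apply: IH.
Qed.

Lemma multsZ V l b (x : V) : mults l x -> mults l (b *: x).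
Proof.
elim: l x => [|l IH] x /=; first by move=> ->; rewrite scaler0.
move=> [u xu]; exists (b *: u).
by rewrite scalerA mulrC -scalerA -scalerBr; apply: IH.
Qed.

Definition mults_submod V l : submod V :=
  Submod (mults0 V l) (@multsD V l) (@multsZ V l).

Lemma multsB V l (x y : V) : mults l x -> mults l y -> mults l (x - y).
Proof. exact: (@submodB _ _ (mults_submod V l)). Qed.

Lemma multsN V l (x : V) : mults l x -> mults l (- x).
Proof. exact: (@submodN _ _ (mults_submod V l)). Qed.

Lemma multsS V l (x y : V) : mults l x -> mults l.+1 (x + a l *: y).
Proof. by exists y; rewrite addrK. Qed.

Lemma mults_map V W l (f : {linear V -> W}) x : mults l x -> mults l (f x).
Proof.
elim: l x => [|l IH] x /=; first by move=> ->; exact: linear0.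
by move=> [u /IH]; rewrite linearB linearZ; exists (f u).
Qed.

(** Reduction modulo the a_i is right exact. *)
Lemma mults_lift V W l (f : {linear V -> W}) y :
  (forall y, exists x, f x = y) -> mults l y -> exists x, f x = y /\ mults l x.
Proof.
move=> f_surj; elim: l y => [|l IH] y /=.
  by move=> ->; exists 0; split=> //; exact: linear0.
move=> [u /IH[x [xE Bx]]]; have [v vE] := f_surj u.
exists (x + a l *: v); rewrite linearD linearZ /= xE vE subrK; split=> //.
by exists v; rewrite addrK.
Qed.

Lemma mults_scaler V l (r : R^o) (x : V) : mults l r -> mults l (r *: x).
Proof.
elim: l r => [|l IH] r /=; first by move=> ->; rewrite scale0r.
by move=> [u /IH Bu]; exists (u *: x); rewrite scalerA -scalerBl.
Qed.

(** The sequence a_0, ..., a_(n-1) is weakly regular on V: properness of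
the submodule it generates is not required. *)
Definition depth V n := forall l, (l < n)%N ->
  forall x : V, mults l (a l *: x) -> mults l x.

Lemma depth_le V m n : (m <= n)%N -> depth V n -> depth V m.
Proof. by move=> lemn dV l ltl; apply: dV; apply: leq_trans lemn. Qed.

Section ShortExact.
Variables (N X M : lmodType R) (i : {linear N -> X}) (q : {linear X -> M}).
Hypothesis iq : short_exact i q.

(** The first Koszul homology of M vanishes by regularity, so N stays a
submodule of X modulo the a_i. *)
Lemma mults_restrict l x : depth M l -> mults l (i x) -> mults l x.
Proof.
have [i_inj eiq q_surj] := iq.
elim: l x => [|l IH] x dM /=; first by rewrite -{1}(linear0 i) => /i_inj.
have {}IH z : mults l (i z) -> mults l z by apply: IH; apply: depth_le dM.
move=> [y By]; have := mults_map q By.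
rewrite linearB (exact_comp0 _ eiq) sub0r => /multsN; rewrite opprK linearZ /=.
move=> /dM-/(_ (ltnSn l))/(mults_lift q_surj)[y' [y'E By']].
have /eiq[w wE] : q (y - y') = 0 by rewrite linearB y'E subrr.
exists w; apply: IH; rewrite linearB linearZ /= wE scalerBr opprB addrA.
by rewrite addrAC addrC; apply: multsD => //; apply: multsZ.
Qed.

(** Depth grows by one at each syzygy, as long as the middle term allows it. *)
Lemma depth_ker n : depth M n -> depth X n.+1 -> depth N n.+1.
Proof.
move=> dM dX l; rewrite ltnS => lel x Bx.
apply: mults_restrict; first exact: depth_le dM.
by apply: dX => //; rewrite -linearZ; apply: mults_map.
Qed.
End ShortExact.

(** Iterating, every module in [Z] has an infinite coresolution by modules in
[P] all of whose cosyzygies lie in [Z]. *)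
Definition coresolving (P Z : lmodType R -> Prop) := forall X, Z X ->
  exists (Y X' : lmodType R) (i : {linear X -> Y}) (q : {linear Y -> X'}),
    [/\ short_exact i q, P Y & Z X'].

(** By induction on m <= n all modules of [Z] have depth m: the cosyzygy has
depth m by induction, and [depth_ker] gives m + 1 for the module itself. *)
Lemma coresolving_depth (P Z : lmodType R -> Prop) n :
  coresolving P Z -> (forall Y, P Y -> depth Y n) -> forall X, Z X -> depth X n.
Proof.
move=> PZ dP; suff dZ m : (m <= n)%N -> forall X, Z X -> depth X m by exact: dZ.
elim: m => [|m IH] lemn X ZX; first by move=> l.
have [Y [X' [i [q [iq PY ZX']]]]] := PZ X ZX.
apply: (depth_ker iq); first exact: IH (ltnW lemn) _ ZX'.
exact: depth_le lemn (dP _ PY).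
Qed.

Section Obstruction.
Variables (Z : lmodType R -> Prop) (n : nat) (T : R -> Prop).
Hypothesis dZ : forall X, Z X -> depth X n.
Hypothesis TZ : forall X, Z X -> forall x : X,
  (forall t, T t -> mults n (t *: x)) -> mults n x.
Hypothesis Ta : forall l, (l < n)%N -> T (a l).

(** The class z modulo a_0, ..., a_(i-1) stands for an element of Ext^i(k, M).
Lift z to x in X.  As a_i z is a combination of a_0, ..., a_(i-1), so is a_i x
up to an element z' of the syzygy N, and z' is the image of z under the
connecting map.  It is again nonzero and killed by [T] modulo the a's, with
i + 1 for i and a resolution of N that is shorter by one.  When the length
is 0 the module is in [Z], where such a class cannot exist. *)
Lemma no_resolution m i M (z : M) : (i + m <= n)%N -> depth M i ->
  ~ mults i z -> (forall t, T t -> mults i (t *: z)) -> ~ has_resolution Z M m.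
Proof.
elim: m i M z => [|m IH] i M z lein dM nBz Tz; rewrite ?addn0 in lein.
  move=> /has_resolution0_inv[X [f [ZX [g fK gK]]]]; apply: nBz.
  have dM' : depth M n.
    move=> l ltl y By; have [gi [giE Bgi]] := mults_lift (fun y => ex_intro _ _ (gK y)) By.
    rewrite -(gK y); apply: mults_map; apply: dZ => //.
    by rewrite -[_ *: _]fK linearZ /= gK -giE fK.
  move: lein; rewrite leq_eqVlt => /orP[/eqP iE|ltin]; last first.
    by apply: dM' => //; apply/Tz/Ta.
  rewrite -(gK z); apply: mults_map; rewrite iE; apply: TZ => // t Tt.
  have [x [xE Bx]] := mults_lift (fun y => ex_intro _ _ (gK y)) (Tz t Tt).
  by rewrite -iE -[_ *: _]fK linearZ /= gK -xE fK.
move=> /has_resolutionS_inv[N [X [j [q [jq ZX resN]]]]].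
have [j_inj ejq q_surj] := jq.
rewrite addnS in lein; have ltin : (i < n)%N := leq_trans (leq_addr m i.+1) lein.
have [x xE] := q_surj z.
have [b [bE Bb]] := mults_lift q_surj (Tz _ (Ta ltin)).
have /ejq[z' z'E] : q (a i *: x - b) = 0.
  by rewrite linearB linearZ /= xE bE subrr.
apply: (IH i.+1 N z' lein _ _ _ resN).
- exact: (depth_ker jq dM (depth_le ltin (dZ ZX))).
- move=> /= [w Bw]; apply: nBz; rewrite -xE.
  have {}Bw := mults_map j Bw; rewrite linearB linearZ /= z'E in Bw.
  have : mults i (a i *: (x - j w)).
    have -> : a i *: (x - j w) = (a i *: x - b - a i *: j w) + b.
      by rewrite scalerBr addrAC subrK.
    exact: multsD.
  move=> /(dZ ZX)-/(_ ltin)/(mults_map q).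
  by rewrite linearB (exact_comp0 _ ejq) subr0.
move=> t Tt; have [b' [b'E Bb']] := mults_lift q_surj (Tz t Tt).
have /ejq[w wE] : q (t *: x - b') = 0 by rewrite linearB linearZ /= xE b'E subrr.
exists w; apply: (mults_restrict jq) => //.
rewrite linearB [j (t *: _)]linearZ [j (a i *: _)]linearZ /= z'E wE.
have -> : t *: (a i *: x - b) - a i *: (t *: x - b') = a i *: b' - t *: b.
  rewrite !scalerBr !scalerA [t * _]mulrC opprB addrC addrA subrK addrC.
  by rewrite addrC.
by apply: multsB; apply: multsZ.
Qed.

End Obstruction.
End Depth.

(** * Gorenstein modules inherit depth *)

Section Coresolutions.
Variable R : comNzRingType.
Implicit Types (M N X Y Q : lmodType R).

(** Going down by one degree in the complex, from the cycles of degree i + 1 to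
those of degree i. *)
Lemma cycle_coresolution (F : complex R) M : acyclic F -> is_cycle_of M F ->
  exists i (M' : lmodType R) (j : {linear M -> F i}) (q : {linear F i -> M'}),
    short_exact j q /\ is_cycle_of M' F.
Proof.
move=> acF [i' [j [j_inj jE]]].
have [i iE] : exists i, i' = i + 1 by exists (i' - 1); rewrite subrK.
case: _ / (esym iE) in j j_inj jE *.
pose K := ker_submod (diff F i).
have dK x : K (diff F (i + 1) x) by exact: diff_diff.
exists (i + 1 + 1), (subm K), j, (cores dK); split; first split=> //.
- move=> y; rewrite -jE; split=> [/(congr1 (@subm_val _ _ K))|dy] //.
  exact: subm_val_inj.
- move=> k; have /acF[x xE] := subm_valP k.
  by exists x; apply: subm_val_inj.
exists i, (@subm_val _ _ K); split; first exact: subm_val_inj.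
move=> y; split=> [ey0|[x <-]]; [exact: (@submP _ _ K) | exact: (subm_valP x)].
Qed.

Lemma GF_coresolving : coresolving (@flat_module R) (@gorenstein_flat R).
Proof.
move=> X [F [flF acF TF /(cycle_coresolution acF)[i [M' [j [q [jq cycM']]]]]]].
by exists (F i), M', j, q; split=> //; exists F; split.
Qed.

Lemma PGF_coresolving : coresolving (@projective_module R) (@PGF R).
Proof.
move=> X [F [flF acF TF /(cycle_coresolution acF)[i [M' [j [q [jq cycM']]]]]]].
by exists (F i), M', j, q; split=> //; exists F; split.
Qed.

Lemma GP_coresolving :
  coresolving (@projective_module R) (@gorenstein_projective R).
Proof.
move=> X [F [flF acF TF /(cycle_coresolution acF)[i [M' [j [q [jq cycM']]]]]]].
by exists (F i), M', j, q; split=> //; exists F; split.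
Qed.

(** Split the surjection onto Q from the free module on the set Q; the
functionals are the coordinates. *)
Lemma projective_dual_basis Q (x : Q) : projective_module Q ->
  exists s : seq ({linear Q -> R^o} * Q), x = \sum_(p <- s) p.1 x *: p.2.
Proof.
move=> prQ; pose p : {linear {malg R[Q]} -> Q} := malg_ext id.
have [|f fE] := prQ _ _ p idfun.
  by move=> y; exists << y >>; rewrite /= malg_extU scale1r.
have coeff_lin y : linear (fun z : Q => (f z)@_y : R^o).
  by move=> b u v; rewrite linearP mcoeffD mcoeffZ.
pose c y : {linear Q -> R^o} :=
  HB.pack (fun z : Q => (f z)@_y : R^o) (GRing.isLinear.Build R Q R^o _ _ (coeff_lin y)).
exists [seq (c y, y) | y <- msupp (f x)].
by rewrite big_map /= -[LHS]fE.
Qed.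

Section ProjectiveDepth.
Variables (a : nat -> R) (n : nat).

Lemma projective_mults Q l (x : Q) : projective_module Q ->
  (forall f : {linear Q -> R^o}, mults a l (f x)) -> mults a l x.
Proof.
move=> prQ fx; have [s ->] := projective_dual_basis x prQ.
by apply: (@submod_sum _ _ (mults_submod a Q l)) => p _; apply: mults_scaler.
Qed.

Lemma projective_depth Q : depth a R^o n -> projective_module Q -> depth a Q n.
Proof.
move=> dR prQ l ltl x Bx; apply: projective_mults => // f.
by apply: dR => //; rewrite -linearZ; apply: mults_map.
Qed.

(** The ideal (a_0, ..., a_(l-1)) as a right ideal, whose quotient can stand on
the left of a tensor product. *)
Definition right_mults (l : nat) : submod (R^c)^o.
Proof.
exists (fun r : R => mults a l (r : R^o)); first exact: mults0.
  by move=> u v; apply: multsD.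
move=> b u Bu; have -> : b *: u = (b : R) *: (u : R^o) by rewrite /GRing.scale /= mulrC.
exact: multsZ.
Defined.

Lemma mults_gen (V : lmodType R) l i (x : V) : (i < l)%N -> mults a l (a i *: x).
Proof.
elim: l => [//|l IH]; rewrite ltnS leq_eqVlt => /orP[/eqP->|/IH Bx].
  by rewrite -[_ *: x]add0r; apply: multsS; apply: mults0.
by rewrite -[_ *: x]addr0 -(scaler0 V (a l)); apply: multsS.
Qed.

Lemma tens_mults (A : lmodType R^c) Q l (c : A) (y : Q) :
  (forall i, (i < l)%N -> (a i : R^c) *: c = 0) -> mults a l y -> tens c y = 0.
Proof.
elim: l y => [|l IH] y ac /=; first by move=> ->; rewrite tens0r.
move=> [u /IH yu]; rewrite -[y](subrK (a l *: u)) tensDr yu ?add0r.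
  by rewrite -tensZ ac // tens0l.
by move=> i lti; apply/ac/ltnW.
Qed.

(** Multiplication by a_l is injective on A = R / (a_0, ..., a_(l-1)), hence on
the tensor product of A with Q, which is Q modulo a_0, ..., a_(l-1). *)
Lemma flat_depth Q : depth a R^o n -> flat_module Q -> depth a Q n.
Proof.
move=> dR flQ l ltl x Bx.
pose A := quo (right_mults l).
pose g : {linear A -> A} := @hom_scale R^c (a l) A.
have piS (u v : R) : quo_pi (right_mults l) u = quo_pi (right_mults l) v <->
    mults a l (u - v : R^o) := quo_piE (right_mults l) u v.
have repr_pi (u : R) : mults a l (repr (quo_pi (right_mults l) u) - u : R^o) :=
  @quo_piK _ _ (right_mults l) u.
have A_surj (q : A) : exists u : R, quo_pi (right_mults l) u = q := quo_surj q.
have piZ (r u : R) : (r : R^c) *: quo_pi (right_mults l) u =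
    quo_pi (right_mults l) (r * u).
  by rewrite -linearZ /=; congr quo_pi; rewrite mulrC.
have g_inj : injective g.
  move=> q q'; have [u <-] := A_surj q; have [v <-] := A_surj q'.
  rewrite /= /hom_scale !piZ => /piS; rewrite -mulrBr => Buv.
  by apply/piS/dR.
have [_ _ _ exg] : [/\ True, True, True & exact_at (\0 : {linear A -> A}) g].
  split=> // y; split=> [gy|[z <-]]; last exact: linear0.
  by exists 0; apply: g_inj; rewrite gy linear0.
have tx0 : tens (quo_pi (right_mults l) 1 : A) x = 0.
  have /(flQ _ _ _ _ _ exg)[z <-] :
      tensor_map g (@idfun Q) (tens (quo_pi (right_mults l) 1 : A) x) = 0.
    rewrite tensor_mapE /= /hom_scale tensZ; apply: tens_mults Bx => i lti.
    rewrite piZ; apply/(quo_pi_eq0 (right_mults l)).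
    exact: (@mults_gen R^o l i 1 lti).
  elim/tensor_ind: z => [u v|c y]; first by rewrite raddfD /= => -> ->; rewrite addr0.
  by rewrite tensor_mapE tens0l.
pose W := quo (mults_submod a Q l).
pose f (q : A) (y : Q) : W := quo_pi (mults_submod a Q l) ((repr q : R) *: y).
have fE (u : R) y : f (quo_pi (right_mults l) u) y = quo_pi _ (u *: y).
  by apply/quo_piE; rewrite -scalerBl; apply: mults_scaler.
have [|||F FE] := @tensor_lift R A Q W f.
- move=> q q' y; have [u <-] := A_surj q; have [v <-] := A_surj q'.
  by rewrite -linearD !fE scalerDl linearD.
- by move=> q y y'; rewrite /f scalerDr linearD.
- move=> q r y; have [u <-] := A_surj q.
  by rewrite piZ !fE scalerA mulrC.
move: tx0 => /(congr1 F); rewrite FE raddf0 fE scale1r.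
exact: (quo_pi_eq0 (mults_submod a Q l) x).1.
Qed.

End ProjectiveDepth.

Section LowerBounds.
Variables (a : nat -> R) (n : nat) (T : R -> Prop) (M : lmodType R) (z : M).
Hypotheses (dR : depth a R^o n) (Ta : forall l, (l < n)%N -> T (a l)).
Hypotheses (z_neq0 : z <> 0) (Tz : forall t, T t -> t *: z = 0).

Lemma no_GF_resolution m : (m < n)%N -> ~ has_resolution (@gorenstein_flat R) M m.
Proof.
case: n dR Ta => [//|n'] dR' Ta'; rewrite ltnS => lemn.
have dZ := coresolving_depth GF_coresolving (fun Y => flat_depth dR').
apply: (@no_resolution _ a (@gorenstein_flat R) n' T _ _ _ m 0 M z) => //.
- by move=> X GX; apply: depth_le (dZ _ GX).
- by move=> X GX x Tx; apply: (dZ X GX) => //; apply/Tx/Ta'.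
- by move=> l ltl; apply/Ta'/ltnW.
Qed.

Hypothesis TR : forall r : R^o, (forall t, T t -> mults a n (t *: r)) -> mults a n r.

Lemma no_projective_resolution (Z : lmodType R -> Prop) m :
  coresolving (@projective_module R) Z -> (m <= n)%N -> ~ has_resolution Z M m.
Proof.
move=> coZ lemn; have dZ := coresolving_depth coZ (fun Y => projective_depth dR).
apply: (@no_resolution _ a Z n T _ _ _ m 0 M z) => //.
move=> X ZX x Tx; have [Y [X' [i [q [iq prY ZX']]]]] := coZ X ZX.
apply: (mults_restrict iq); first exact: dZ.
apply: projective_mults => // f; apply: TR => t Tt.
by rewrite -[t *: f _]linearZ -[t *: i _]linearZ; apply/mults_map/mults_map/Tx.
Qed.
End LowerBounds.
End Coresolutions.

(** * Exact pairs of ring elements *)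

Section ExactPairs.
Variable R : comNzRingType.

(** Multiplication by y followed by multiplication by x is exact on R. *)
Definition exact_pair (x y : R) := forall r : R, x * r = 0 <-> exists r', r = y * r'.

Lemma exact_pair0 x y : exact_pair x y -> x * y = 0.
Proof. by move=> xy; apply/xy; exists 1; rewrite mulr1. Qed.

Lemma exact_pair_projective x y (Q : lmodType R) (v : Q) :
  exact_pair x y -> projective_module Q -> x *: v = 0 -> exists w, v = y *: w.
Proof.
move=> xy prQ xv; have [s vE] := projective_dual_basis v prQ.
suff S : exists w, y *: w = \sum_(p <- s) p.1 v *: p.2.
  by case: S => w wE; exists w; rewrite vE -wE.
apply: (@submod_sum _ _ (im_submod (@hom_scale R y Q))) => p _ /=.
have /xy[r rE] : x * p.1 v = 0 by rewrite -[RHS](linear0 p.1) -xv linearZ.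
by exists (r *: p.2); rewrite /hom_scale scalerA -rE.
Qed.

(** The map x r |-> r v on the ideal x R is well defined, because the annihilator
of x is generated by y and y kills v; it extends to R as I is injective, and
then v is x times the image of 1. *)
Lemma exact_pair_injective x y (I : lmodType R^c) (v : I) :
  exact_pair x y -> injective_module I -> (y : R^c) *: v = 0 ->
  exists w, v = (x : R^c) *: w.
Proof.
move=> xy injI yv.
pose A := im_submod (@hom_scale R^c x (R^c)^o).
have AP (u : subm A) : exists r : R, x * r = subm_val u.
  by have [r rE] := subm_valP u; exists r; rewrite -[RHS]rE /hom_scale /= mulrC.
have [g gE] := choice AP.
pose f u : I := (g u : R^c) *: v.
have fE (u : subm A) (r : R) : x * r = subm_val u -> f u = (r : R^c) *: v.
  move=> rE; apply/subr0_eq; rewrite /f -scalerBl.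
  have /xy[r' r'E] : x * (g u - r) = 0 by rewrite mulrBr gE rE subrr.
  rewrite [_ - _ : R^c]r'E.
  have -> : (y * r' : R) = (r' : R^c) * (y : R^c) by [].
  by rewrite -scalerA yv scaler0.
have f_lin : linear f.
  move=> b u w; rewrite (fE _ ((b : R) * g u + g w)).
    rewrite scalerDl; congr (_ + _); rewrite mulrC.
    have -> : (g u * b : R) = (b : R^c) * (g u : R^c) by [].
    by rewrite -scalerA.
  rewrite mulrDr mulrCA !gE linearD linearZ /=; congr (_ + _).
  by rewrite mulrC.
pose F : {linear subm A -> I} := HB.pack f (GRing.isLinear.Build R^c (subm A) I _ _ f_lin).
have [F' F'E] := injI _ _ (@subm_val _ _ A) F (@subm_val_inj _ _ A).
have /(@submP _ _ A)[u uE] : A (x : (R^c)^o).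
  by exists 1; exact: (@mulr1 R^c x).
have xu : (x : R^c) *: (1 : (R^c)^o) = subm_val u by rewrite uE; exact: (@mulr1 R^c x).
exists (F' 1); rewrite -linearZ xu F'E /=.
by rewrite (fE _ 1) ?scale1r // mulr1 uE.
Qed.

End ExactPairs.

Section PolyLin.
Variables (R : comNzRingType) (V : lmodType R) (y : nat -> V).

(** [{poly R}] is used as the free module with basis the powers of 'X. *)
Definition polylin (p : {poly R}) : V := \sum_(i < size p) p`_i *: y i.

Lemma polylinEw n (p : {poly R}) :
  (size p <= n)%N -> polylin p = \sum_(i < n) p`_i *: y i.
Proof.
move=> len; rewrite /polylin (big_ord_widen n (fun i => p`_i *: y i)) // big_mkcond /=.
apply: eq_bigr => i _; case: ltnP => // le_i.
by rewrite nth_default // scale0r.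
Qed.

Fact polylin_is_linear : linear polylin.
Proof.
move=> b p q; pose n := maxn (size p) (size q).
rewrite (@polylinEw n (b *: p + q)); last first.
  apply: leq_trans (size_polyD _ _) _; rewrite geq_max leq_maxr andbT.
  exact: leq_trans (size_scale_leq _ _) (leq_maxl _ _).
rewrite (@polylinEw n p) ?leq_maxl // (@polylinEw n q) ?leq_maxr //.
rewrite scaler_sumr -big_split; apply: eq_bigr => i _.
by rewrite coefD coefZ scalerDl scalerA.
Qed.
HB.instance Definition _ :=
  GRing.isLinear.Build R {poly R} V _ polylin polylin_is_linear.

Lemma polylinXn i : polylin 'X^i = y i.
Proof.
rewrite (@polylinEw i.+1) ?size_polyXn // big_ord_recr /= big1 ?add0r.
  by rewrite coefXn eqxx scale1r.
by move=> j _; rewrite coefXn ltn_eqF ?scale0r.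
Qed.
End PolyLin.

Section PolyExt.
Variables (R : comNzRingType).

Lemma poly_linear_ext (V : lmodType R) (f g : {linear {poly R} -> V}) :
  (forall i, f 'X^i = g 'X^i) -> forall p, f p = g p.
Proof.
move=> fg p; rewrite -[p]coefK poly_def !linear_sum.
by apply: eq_bigr => i _; rewrite !linearZ /= fg.
Qed.

Lemma projective_poly : projective_module ({poly R} : lmodType R).
Proof.
move=> A B p f p_surj.
have [y yE] := choice (fun i : nat => p_surj (f 'X^i)).
exists (polylin y) => q.
apply: (@poly_linear_ext _ (p \o polylin y) f) => i.
by rewrite /= polylinXn yE.
Qed.

(** With the next lemma, the isomorphism of the tensor product of B and R
with B. *)
Lemma tensor_regular (B : lmodType R^c) (z : tensor B (R^o : lmodType R)) :
  exists b, z = tens b 1.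
Proof.
elim/tensor_ind: z => [_ _ [b ->] [b' ->]|b r].
  by exists (b + b'); rewrite tensDl.
by exists ((r : R^c) *: b); rewrite tensZ; congr tens; rewrite [_ *: _]mulr1.
Qed.

Lemma tens_regular_eq0 (B : lmodType R^c) (b : B) (r : R) :
  tens b (r : R^o) = 0 -> (r : R^c) *: b = 0.
Proof.
have [|||F FE] := @tensor_lift R B R^o B (fun c (r : R^o) => (r : R^c) *: c).
- by move=> w w' u; rewrite scalerDr.
- by move=> w u u'; rewrite scalerDl.
- by move=> w u u'; rewrite scalerA.
by move=> /(congr1 F); rewrite FE raddf0.
Qed.

Lemma flat_regular : flat_module (R^o : lmodType R).
Proof.
move=> A B C f g fg; apply: exact_atI => z.
  have [b ->] := tensor_regular z.
  by rewrite !tensor_mapE (exact_comp0 _ fg) tens0l.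
have [b ->] := tensor_regular z; rewrite tensor_mapE => /tens_regular_eq0.
rewrite scale1r => /fg[x xE].
by exists (tens x 1); rewrite tensor_mapE xE.
Qed.

Definition diag (x : nat -> R) : {linear {poly R} -> {poly R}} :=
  polylin (fun i => x i *: 'X^i : {poly R}).

Lemma diagXn x i : diag x 'X^i = x i *: 'X^i.
Proof. exact: polylinXn. Qed.

Lemma coef_diag x p i : (diag x p)`_i = x i * p`_i.
Proof.
rewrite /= (@polylinEw _ _ _ (maxn (size p) i.+1)) ?leq_maxl // coef_sum.
have lti : (i < maxn (size p) i.+1)%N by rewrite leq_maxr.
rewrite (bigD1 (Ordinal lti)) //= big1 ?addr0 => [|j].
  by rewrite !coefZ coefXn eqxx mulr1 mulrC.
rewrite -val_eqE /= => neq; rewrite !coefZ coefXn [i == _]eq_sym (negbTE neq).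
by rewrite !mulr0.
Qed.

Lemma tensor_poly (B : lmodType R^c) (z : tensor B ({poly R} : lmodType R)) :
  exists n (b : nat -> B), z = \sum_(i < n) tens (b i) 'X^i.
Proof.
have widen n m (b : nat -> B) : (n <= m)%N ->
    \sum_(i < n) tens (b i) ('X^i : {poly R}) =
    \sum_(i < m) tens (if (i < n)%N then b i else 0) ('X^i : {poly R}).
  move=> lenm; rewrite (big_ord_widen m (fun i => tens (b i) ('X^i : {poly R}))) //.
  by rewrite big_mkcond; apply: eq_bigr => i _; case: ifP; rewrite ?tens0l.
elim/tensor_ind: z => [_ _ [n [b ->]] [n' [b' ->]]|b p].
  rewrite (widen n (maxn n n')) ?leq_maxl // (widen n' (maxn n n')) ?leq_maxr //.
  rewrite -big_split /=; eexists; exists (fun i : nat =>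
    (if (i < n)%N then b i else 0) + (if (i < n')%N then b' i else 0)).
  by apply: eq_bigr => i _; rewrite tensDl.
exists (size p), (fun i => (p`_i : R^c) *: b).
rewrite -{1}[p]coefK poly_def tens_sumr; apply: eq_bigr => i _.
by rewrite tensZ.
Qed.

Section DiagExact.
Variables (x y : nat -> R).
Hypotheses (xy : forall i, exact_pair (x i) (y i)).
Hypotheses (yx : forall i, exact_pair (y i) (x i)).

Let diag_diag p : diag y (diag x p) = 0.
Proof.
apply/polyP => i; rewrite !coef_diag coef0 mulrA (exact_pair0 (yx i)).
by rewrite mul0r.
Qed.

Lemma diag_exact : exact_at (diag x) (diag y).
Proof.
apply: exact_atI => // p yp.
have pP i : exists r, p`_i = x i * r.
  by apply/yx; rewrite -coef_diag yp coef0.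
have [r rE] := choice pP.
exists (\poly_(i < size p) r i); apply/polyP => i; rewrite coef_diag coef_poly.
by case: ltnP => [_|lei]; rewrite ?rE // mulr0 -rE nth_default.
Qed.

(** After tensoring or taking Hom the complex splits into its coordinates,
and each coordinate is an instance of an exact pair acting on I or on Q. *)
Lemma diag_total : proj_total (diag x) (diag y).
Proof.
split=> [I injI|Q prQ w].
  apply: exact_atI => [z|z].
    rewrite (tensor_map_comp (f2 := idfun) (g2 := \0)) //.
    exact: tensor_map0.
  have [n [b ->]] := tensor_poly z; rewrite raddf_sum /= => zE.
  have coefP (i : nat) : exists F : {additive tensor I ({poly R} : lmodType R) -> I},
      forall c (p : {poly R}), F (tens c p) = (p`_i : R^c) *: c.
    apply: tensor_lift => [c c' p|c p p'|c r p].
    - by rewrite scalerDr.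
    - by rewrite coefD scalerDl.
    - by rewrite scalerA coefZ.
  have [F FE] := choice coefP.
  have bP (i : nat) : exists c, (i < n)%N -> b i = (x i : R^c) *: c.
    case: (ltnP i n) => [lti|_]; last by exists 0.
    have [|c ->] := exact_pair_injective (v := b i) (xy i) injI; last by exists c.
    have := congr1 (F i) zE; rewrite raddf0 raddf_sum (bigD1 (Ordinal lti)) //=.
    rewrite big1 ?addr0 => [|j]; last first.
      rewrite -val_eqE /= => neq; rewrite tensor_mapE FE /= coef_diag coefXn.
      by rewrite [i == _]eq_sym (negbTE neq) mulr0 scale0r.
    by rewrite tensor_mapE FE /= coef_diag coefXn eqxx mulr1.
  have [c cE] := choice bP.
  exists (\sum_(i < n) tens (c i) 'X^i); rewrite raddf_sum; apply: eq_bigr => i _ /=.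
  by rewrite (cE i (ltn_ord i)) tensZ tensor_mapE; congr tens; apply: diagXn.
split=> [wx|[v vE] p]; last first.
  by rewrite -vE -[RHS](linear0 v); congr (v _); apply: diag_diag.
have wP i : exists q, w 'X^i = y i *: q.
  apply: exact_pair_projective (xy i) prQ _.
  by rewrite -linearZ -[RHS](wx 'X^i) diagXn.
have [q qE] := choice wP; exists (polylin q).
apply: (@poly_linear_ext _ (polylin q \o diag y) w) => i.
by rewrite [LHS]/= diagXn linearZ /= polylinXn qE.
Qed.
End DiagExact.
End PolyExt.

(** * The telescope and its colimit *)

Definition eventually (P : nat -> Prop) := exists J, forall j, (J <= j)%N -> P j.

(** A detection principle for zero tensors by maps e_j that are only
asymptotically linear: a derivation that the tensor is zero uses finitely many
relations, all of which e_j respects for large j. *)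
Lemma tens_eq0_eventually (R : comNzRingType) (B : lmodType R^c) (V : lmodType R)
    (e : nat -> V -> R) :
  (forall x y, eventually (fun j => e j (x + y) = e j x + e j y)) ->
  (forall r x, eventually (fun j => e j (r *: x) = r * e j x)) ->
  forall (b : B) x, tens b x = 0 -> eventually (fun j => (e j x : R^c) *: b = 0).
Proof.
move=> eD eZ b x.
have [E [EB EU]] : exists E : nat -> {malg int[(B * V)%type]} -> B,
    (forall j u v, E j (u - v) = E j u - E j v) /\
    (forall j a y, E j << (a, y) >> = (e j y : R^c) *: a).
  exists (fun j => malg_ext (fun p : B * V => ((e j p.2 : R^c) *: p.1 : zmodule B))).
  split=> [j u v|j a y]; last by rewrite malg_extU scale1r.
  by rewrite (raddfB (malg_ext (fun p : B * V => ((e j p.2 : R^c) *: p.1 : zmodule B)))).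
have E0 j : E j 0 = 0 by rewrite -[X in E j X](subrr 0) EB subrr.
suff EP z : tensor_rel z -> eventually (fun j => E j z = 0).
  move=> /tens_eq0/EP[J JP]; exists J => j /JP.
  by rewrite EU.
elim=> [|u v _ [J uJ] _ [J' vJ]|a a' y|a y y'|a r y].
- by exists 0%N => j _; exact: E0.
- exists (maxn J J') => j; rewrite geq_max => /andP[lJ lJ'].
  by rewrite EB uJ // vJ // subrr.
- by exists 0%N => j _; rewrite !EB !EU scalerDr -addrA -opprD subrr.
- have [J JP] := eD y y'; exists J => j /JP ej.
  by rewrite !EB !EU ej scalerDl -addrA -opprD subrr.
- have [J JP] := eZ r y; exists J => j /JP ej.
  by rewrite !EB !EU ej scalerA subrr.
Qed.

Section Telescope.
Variables (R : comNzRingType) (s N c : nat -> R).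
Hypothesis sN : forall j, exact_pair (s j) (N j).
Hypothesis Ns : forall j, exact_pair (N j) (s j).
Hypothesis sc : forall j, s j = c j * s j.+1.
Hypothesis Nc : forall j, N j.+1 = c j * N j.

(** [ev j p] is the image in the j-th copy of R of the element p_0 + ... + p_j
of the first j + 1 copies, in the system R -c_0-> R -c_1-> ... . *)
Fixpoint ev j (p : {poly R}) : R :=
  if j is i.+1 then ev i p * c i + p`_i.+1 else p`_0.

Lemma ev_is_linear j : linear (ev j : {poly R} -> R^o).
Proof.
move=> b p q; elim: j => [|j IH] /=; first by rewrite coefD coefZ.
by rewrite IH coefD coefZ /GRing.scale /= mulrDr mulrDl addrACA mulrA.
Qed.
HB.instance Definition _ j :=
  GRing.isLinear.Build R {poly R} R^o _ (ev j : {poly R} -> R^o) (@ev_is_linear j).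

Lemma evD j p q : ev j (p + q) = ev j p + ev j q.
Proof. exact: (linearD (ev j : {linear {poly R} -> R^o})). Qed.
Lemma evB j p q : ev j (p - q) = ev j p - ev j q.
Proof. exact: (linearB (ev j : {linear {poly R} -> R^o})). Qed.
Lemma evZ j b p : ev j (b *: p) = b * ev j p.
Proof.
have := ev_is_linear j b p 0; rewrite !addr0 => ->.
by rewrite (linear0 (ev j : {linear {poly R} -> R^o})) addr0.
Qed.

Lemma ev_vanish m j (p : {poly R}) :
  (size p <= m.+1)%N -> (m <= j)%N -> ev m p = 0 -> ev j p = 0.
Proof.
move=> lem lemj evm; elim: j lemj => [|j IH]; first by rewrite leqn0 => /eqP <-.
rewrite leq_eqVlt => /orP[/eqP <- //|]; rewrite ltnS => /[dup] lemj /IH /= ->.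
by rewrite mul0r add0r nth_default // (leq_trans lem) // ltnS leqW.
Qed.

(** The elements of the direct sum of copies of R that vanish in the colimit of
R -c_0-> R -c_1-> ... . *)
Definition null_submod : submod {poly R}.
Proof.
exists (fun p => eventually (fun j => ev j p = 0)).
- by exists 0%N => j _; apply: (linear0 (ev j : {linear {poly R} -> R^o})).
- move=> p q [J pJ] [J' qJ]; exists (maxn J J') => j; rewrite geq_max => /andP[le1 le2].
  by rewrite evD pJ // qJ // addr0.
- move=> b p [J pJ]; exists J => j lej.
  by rewrite evZ pJ // mulr0.
Defined.

(** The module L: the generator of the j-th copy of R is [ell j], and
[ell j = c j *: ell j.+1]. *)
Definition colim := quo null_submod.
HB.instance Definition _ := GRing.Lmodule.on colim.

Definition colim_pi : {linear {poly R} -> colim} := quo_pi null_submod.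

Lemma colim_pi_eq0 p : colim_pi p = 0 <-> eventually (fun j => ev j p = 0).
Proof. exact: (quo_pi_eq0 null_submod). Qed.

Definition ell j : colim := colim_pi 'X^j.

Lemma ev_Xn j : ev j 'X^j = 1.
Proof.
have ev0 i m : (i < m)%N -> ev i 'X^m = 0.
  elim: i => [|i IH] ltm /=; first by rewrite coefXn ltn_eqF.
  by rewrite (IH (ltnW ltm)) mul0r add0r coefXn ltn_eqF.
case: j => [|j] /=; rewrite coefXn eqxx //.
by rewrite ev0 // mul0r add0r.
Qed.

Lemma colim_pi_ev j (p : {poly R}) : (size p <= j.+1)%N -> colim_pi p = ev j p *: ell j.
Proof.
move=> lej; apply/subr0_eq; rewrite -linearZ -linearB; apply/colim_pi_eq0.
exists j => i leij; apply: ev_vanish leij _.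
  apply: leq_trans (size_polyD _ _) _; rewrite size_polyN geq_max lej /=.
  by apply: leq_trans (size_scale_leq _ _) _; rewrite size_polyXn.
by rewrite evB evZ ev_Xn mulr1 subrr.
Qed.

Lemma colim_ell (x : colim) : exists j r, x = r *: ell j.
Proof.
have [p <-] := quo_surj x; exists (size p), (ev (size p) p).
exact: colim_pi_ev.
Qed.

Lemma ellS j : ell j = c j *: ell j.+1.
Proof.
rewrite /ell (@colim_pi_ev j.+1) ?size_polyXn // /= ev_Xn mul1r coefXn.
by rewrite gtn_eqF ?addr0.
Qed.

Lemma ell_le i j : (i <= j)%N -> exists r, ell i = r *: ell j.
Proof.
move=> /subnK <-; elim: (j - i)%N => [|m [r ->]]; first by exists 1; rewrite scale1r.
by exists (r * c (m + i)%N); rewrite addSn -scalerA -ellS.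
Qed.

Lemma N_ell j : N j *: ell j = N 0%N *: ell 0.
Proof.
by elim: j => [//|j <-]; rewrite Nc mulrC -scalerA -ellS.
Qed.

Lemma polylin_ev j (p : {poly R}) :
  \sum_(i < j.+1) p`_i *: (s i : R^o) = ev j p * s j.
Proof.
elim: j => [|j IH]; first by rewrite big_ord1.
by rewrite big_ord_recr /= IH sc mulrA mulrDl.
Qed.

Fact polylin_null p : null_submod p -> polylin (s : nat -> R^o) p = 0.
Proof.
move=> [J pJ]; rewrite (@polylinEw _ _ _ (maxn J (size p)).+1).
  by rewrite polylin_ev pJ ?leq_maxl // mul0r.
by rewrite leqW // leq_maxr.
Qed.

(** The colimit of the multiplications by s_j. *)
Definition gamma : {linear colim -> R^o} := quo_lift polylin_null.

Lemma gamma_ell j : gamma (ell j) = s j.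
Proof.
rewrite -[RHS](polylinXn (s : nat -> R^o)).
exact: (quo_lift_pi polylin_null).
Qed.

Lemma gammaZ_ell r j : gamma (r *: ell j) = r * s j.
Proof. by rewrite linearZ gamma_ell. Qed.

Definition nu_fun (r : R^o) : colim := (r * N 0%N) *: ell 0.
Fact nu_is_linear : linear nu_fun.
Proof. by move=> b r r'; rewrite /nu_fun mulrDl scalerDl scalerA mulrA. Qed.
HB.instance Definition _ :=
  GRing.isLinear.Build R R^o colim _ nu_fun nu_is_linear.
(** The colimit of the multiplications by N_j, by [nuE]. *)
Definition nu : {linear R^o -> colim} := nu_fun.

Lemma nuE j r : nu r = (r * N j) *: ell j.
Proof. by rewrite /= /nu_fun -!scalerA (N_ell j). Qed.

Lemma ev_const j (r : R) : ev j (r * N 0%N)%:P = r * N j.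
Proof.
elim: j => [|j IH]; first by rewrite /= coefC.
by rewrite /= IH coefC /= addr0 Nc mulrAC mulrA.
Qed.

Lemma nu_colim_pi r : nu r = colim_pi (r * N 0%N)%:P.
Proof. by rewrite (@colim_pi_ev 0) ?size_polyC_leq1 //= coefC. Qed.

Lemma nu_eq0 r : nu r = 0 -> exists j, r * N j = 0.
Proof.
by rewrite nu_colim_pi => /colim_pi_eq0[J rJ]; exists J; rewrite -ev_const rJ.
Qed.

(** Exactness at a finite stage j is that of (s_j, N_j), and every element of
the colimit comes from a finite stage. *)
Lemma nu_gamma : exact_at nu gamma.
Proof.
apply: exact_atI => [r|x].
  by rewrite (nuE 0) gammaZ_ell -mulrA (exact_pair0 (Ns 0)) mulr0.
have [j [r ->]] := colim_ell x; rewrite gammaZ_ell => rs.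
have /sN[r' ->] : s j * r = 0 by rewrite mulrC.
by exists r'; rewrite (nuE j) mulrC.
Qed.

Lemma gamma_nu : exact_at gamma nu.
Proof.
apply: exact_atI => [x|r /nu_eq0[j]].
  have [j [r ->]] := colim_ell x.
  by rewrite gammaZ_ell (nuE j) -mulrA (exact_pair0 (sN j)) mulr0 scale0r.
rewrite mulrC => /Ns[r' ->]; exists (r' *: ell j).
by rewrite gammaZ_ell mulrC.
Qed.

Section TensorColim.
Variable B : lmodType R^c.

Lemma tensor_ell_raise (b : B) i j : (i <= j)%N ->
  exists b', tens b (ell i) = tens b' (ell j).
Proof.
move=> /ell_le[r ->]; exists ((r : R^c) *: b); by rewrite tensZ.
Qed.

Lemma tensor_ell (z : tensor B colim) : exists j b, z = tens b (ell j).
Proof.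
elim/tensor_ind: z => [_ _ [i [b ->]] [j [b' ->]]|b x].
  have [u ->] := tensor_ell_raise b (leq_maxl i j).
  have [v ->] := tensor_ell_raise b' (leq_maxr i j).
  by exists (maxn i j), (u + v); rewrite tensDl.
have [j [r ->]] := colim_ell x; exists j, ((r : R^c) *: b).
by rewrite tensZ.
Qed.

(** Through the chosen representatives this is not additive, but it is so for
large j. *)
Definition colim_ev j (x : colim) : R := ev j (repr x).

Lemma colim_ev_pi (p : {poly R}) :
  eventually (fun j => colim_ev j (colim_pi p) = ev j p).
Proof.
have [J JP] : null_submod (repr (colim_pi p) - p) := quo_piK null_submod p.
by exists J => j /JP; rewrite evB => /subr0_eq.
Qed.

Lemma colim_evD (x y : colim) :
  eventually (fun j => colim_ev j (x + y) = colim_ev j x + colim_ev j y).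
Proof.
have [p1 <-] := quo_surj x; have [p2 <-] := quo_surj y.
have [J1 P1] := colim_ev_pi p1; have [J2 P2] := colim_ev_pi p2.
have [J3 P3] := colim_ev_pi (p1 + p2).
exists (maxn J1 (maxn J2 J3)) => j; rewrite !geq_max => /and3P[l1 l2 l3].
by rewrite P1 // P2 // -linearD P3 // evD.
Qed.

Lemma colim_evZ (r : R) (x : colim) :
  eventually (fun j => colim_ev j (r *: x) = r * colim_ev j x).
Proof.
have [p1 <-] := quo_surj x; have [J1 P1] := colim_ev_pi p1.
have [J3 P3] := colim_ev_pi (r *: p1).
exists (maxn J1 J3) => j; rewrite !geq_max => /andP[l1 l3].
by rewrite P1 // -linearZ P3 // evZ.
Qed.

Lemma tens_eq0_ev (b : B) (x : colim) : tens b x = 0 ->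
  eventually (fun j => (colim_ev j x : R^c) *: b = 0).
Proof. exact: (tens_eq0_eventually colim_evD colim_evZ). Qed.

Lemma tens_nu_eq0 (b : B) : tens b (nu 1) = 0 -> exists j, (N j : R^c) *: b = 0.
Proof.
rewrite nu_colim_pi => /tens_eq0_ev[J JP].
have [J' J'P] := colim_ev_pi (1 * N 0%N)%:P.
exists (maxn J J'); rewrite -[N _]mul1r -ev_const -J'P ?leq_maxr //.
by apply: JP; rewrite leq_maxl.
Qed.

Lemma tens_ell_eq0 (b : B) i : tens b (ell i) = 0 ->
  exists j r, ell i = r *: ell j /\ (r : R^c) *: b = 0.
Proof.
move=> /tens_eq0_ev[J JP]; set p := repr (ell i).
exists (maxn J (size p)), (ev (maxn J (size p)) p); split; last first.
  by apply: JP; rewrite leq_maxl.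
by rewrite -colim_pi_ev ?leqW ?leq_maxr // [RHS]quo_pi_repr.
Qed.
End TensorColim.

(** A tensor comes from a single stage, where L looks like R; if it becomes zero
then it does so at some later stage. *)
Lemma flat_colim : flat_module (colim : lmodType R).
Proof.
move=> A B C f g fg; apply: exact_atI => z.
  have [i [b ->]] := tensor_ell z.
  by rewrite !tensor_mapE (exact_comp0 _ fg) tens0l.
have [i [b ->]] := tensor_ell z; rewrite tensor_mapE /=.
move=> /tens_ell_eq0[j [r [-> gb]]].
have /fg[a aE] : g ((r : R^c) *: b) = 0 by rewrite linearZ.
by exists (tens a (ell j)); rewrite tensor_mapE aE tensZ.
Qed.

Lemma tensor_nu_gamma : inj_tensor_exact nu gamma.
Proof.
move=> I injI; apply: exact_atI => z.
  rewrite (tensor_map_comp (f2 := idfun) (g2 := \0)) //; last first.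
    by move=> r; apply: exact_comp0 nu_gamma.
  exact: tensor_map0.
have [j [b ->]] := tensor_ell z; rewrite tensor_mapE gamma_ell => /tens_regular_eq0.
move=> /(exact_pair_injective (Ns j) injI)[b' bE].
have {bE} -> : b = _ := bE.
exists (tens b' 1); rewrite tensor_mapE tensZ (nuE j) mul1r.
by [].
Qed.

Lemma tensor_gamma_nu : inj_tensor_exact gamma nu.
Proof.
move=> I injI; apply: exact_atI => z.
  rewrite (tensor_map_comp (f2 := idfun) (g2 := \0)) //; last first.
    by move=> r; apply: exact_comp0 gamma_nu.
  exact: tensor_map0.
have [b ->] := tensor_regular z; rewrite tensor_mapE => /tens_nu_eq0[j].
move=> /(exact_pair_injective (sN j) injI)[b' bE].
have {bE} -> : b = _ := bE.
exists (tens b' (ell j)); rewrite tensor_mapE gamma_ell tensZ.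
by congr tens; rewrite [RHS]mulr1.
Qed.

(** The module K, the colimit of the R/s_j R, which sits in L as the kernel of
[gamma] and as the image of [nu]. *)
Definition colim_ker := subm (ker_submod gamma).
HB.instance Definition _ := GRing.Lmodule.on colim_ker.

Lemma periodic_colim_ker :
  periodic (@flat_module R) (@inj_tensor_exact R) (colim_ker : lmodType R).
Proof.
exists colim, R^o, gamma, nu; split.
- by split; [apply: flat_colim | apply: flat_regular].
- by split; [apply: gamma_nu | apply: nu_gamma].
- exact: tensor_gamma_nu.
- exact: tensor_nu_gamma.
exists (@subm_val _ _ (ker_submod gamma)); split; first exact: subm_val_inj.
move=> y; split=> [ey0|[x <-]]; first exact: (@submP _ _ (ker_submod gamma)).
exact: (subm_valP x).
Qed.

(** The annihilator of s_j in R is N_j R, which is R/s_j R; so this is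
the direct sum of the R/s_j R. *)
Definition tel := subm (ker_submod (diag s)).
HB.instance Definition _ := GRing.Lmodule.on tel.

Lemma periodic_tel :
  periodic (@projective_module R) (@proj_total R) (tel : lmodType R).
Proof.
exists {poly R}, {poly R}, (diag s), (diag N); split.
- by split; exact: projective_poly.
- by split; apply: diag_exact.
- exact: diag_total.
- exact: diag_total.
exists (@subm_val _ _ (ker_submod (diag s))); split; first exact: subm_val_inj.
move=> y; split=> [ey0|[x <-]]; first exact: (@submP _ _ (ker_submod (diag s))).
exact: (subm_valP x).
Qed.

(** One minus the transition map, which sends the j-th copy of R to the next one
by c_j. *)
Definition tel_fun (p : {poly R}) : {poly R} := p - diag c p * 'X.
Fact tel_is_linear : linear tel_fun.
Proof.
move=> b p q; rewrite /tel_fun linearP mulrDl -scalerAl scalerBr opprD.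
by rewrite addrACA.
Qed.
HB.instance Definition _ :=
  GRing.isLinear.Build R {poly R} {poly R} _ tel_fun tel_is_linear.

Lemma coef_tel0 p : (tel_fun p)`_0 = p`_0.
Proof. by rewrite /tel_fun coefB coefMX subr0. Qed.

Lemma coef_telS p i : (tel_fun p)`_i.+1 = p`_i.+1 - c i * p`_i.
Proof. by rewrite /tel_fun coefB coefMX coef_diag. Qed.

Lemma diag_eq0 (p : {poly R}) : diag s p = 0 <-> forall i, s i * p`_i = 0.
Proof.
split=> [sp i|sp]; first by rewrite -coef_diag sp coef0.
by apply/polyP => i; rewrite coef_diag coef0.
Qed.

Lemma tel_map_subproof (x : tel) : diag s (tel_fun (subm_val x)) = 0.
Proof.
have /diag_eq0 sx : diag s (subm_val x) = 0 := subm_valP x.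
apply/diag_eq0 => -[|i]; first by rewrite coef_tel0.
by rewrite coef_telS mulrBr sx mulrCA mulrA -sc sx subrr.
Qed.

Lemma tel_aug_subproof (x : tel) : gamma (colim_pi (subm_val x)) = 0.
Proof.
have /diag_eq0 sx : diag s (subm_val x) = 0 := subm_valP x.
rewrite (colim_pi_ev (leqnSn _)) gammaZ_ell -polylin_ev.
by apply: big1 => i _; apply: etrans (sx i); exact: mulrC.
Qed.

Lemma tel_ev (p : {poly R}) (w : {poly R}) :
  (forall j, w`_j = ev j p) -> tel_fun w = p.
Proof.
move=> wE; apply/polyP => -[|i]; first by rewrite coef_tel0 wE.
by rewrite coef_telS !wE /= mulrC addrAC subrr add0r.
Qed.

(** The partial sums [ev] invert the telescope, which gives both its injectivity
and, through [tel_ev], the description of its image. *)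
Lemma ev_tel j p : ev j (tel_fun p) = p`_j.
Proof.
elim: j => [|j IH] /=; first exact: coef_tel0.
by rewrite IH coef_telS mulrC addrCA subrr addr0.
Qed.

Definition tel_map : {linear tel -> tel} :=
  cores (tel_map_subproof : forall x, ker_submod (diag s)
    ((tel_fun \o @subm_val _ _ (ker_submod (diag s))) x)).
Definition tel_aug : {linear tel -> colim_ker} :=
  cores (tel_aug_subproof : forall x, ker_submod gamma
    ((colim_pi \o @subm_val _ _ (ker_submod (diag s))) x)).

Lemma telescope_exact : short_exact tel_map tel_aug.
Proof.
split.
- move=> x y /(congr1 (@subm_val _ _ (ker_submod (diag s)))) /= exy.
  apply: subm_val_inj; apply/polyP => j; rewrite -!ev_tel; by rewrite exy.
- apply: exact_atI => [x|x].
    apply: subm_val_inj; apply/colim_pi_eq0; exists (size (subm_val x)) => j lej.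
    by rewrite /= ev_tel nth_default.
  move=> /(congr1 (@subm_val _ _ (ker_submod gamma)))/colim_pi_eq0[J JP].
  pose w := \poly_(j < J) ev j (subm_val x).
  have wE j : w`_j = ev j (subm_val x).
    by rewrite coef_poly; case: ltnP => // /JP.
  have sw : ker_submod (diag s) w.
    have /diag_eq0 sx : diag s (subm_val x) = 0 := subm_valP x.
    apply/diag_eq0 => j; rewrite wE; elim: j => [|j IH] /=; first exact: sx.
    by rewrite mulrDr sx addr0 mulrC -mulrA -sc mulrC.
  have [y yE] := submP sw; exists y; apply: subm_val_inj.
  by rewrite /= yE; apply: tel_ev.
move=> y; have [j [r rE]] := colim_ell (subm_val y).
have sr : ker_submod (diag s) (r *: 'X^j).
  have rs : gamma (subm_val y) = 0 := subm_valP y.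
  rewrite rE gammaZ_ell in rs.
  rewrite -[in_submod _ _]/(diag s (r *: 'X^j) = 0) linearZ diagXn /=.
  by rewrite scalerA rs scale0r.
have [x xE] := submP sr; exists x; apply: subm_val_inj.
by rewrite /= xE rE linearZ.
Qed.

End Telescope.

(** * Regular sequences and the dimensions over a commutative ring *)

Lemma has_resolution_sub (R : pzRingType) (C C' : lmodType R -> Prop) M n :
  (forall X, C X -> C' X) -> has_resolution C M n -> has_resolution C' M n.
Proof.
move=> CC' [X [d [e [CX X0 e_surj de dd]]]].
by exists X, d, e; split=> // i lei; apply/CC'/CX.
Qed.

Section Koszul.
Variables (R : comNzRingType) (a : nat -> R) (C : lmodType R -> Prop).
Hypothesis CP : forall X Y, C X -> C Y -> C (X * Y)%type.
Hypothesis CZ : forall X, zero_module X -> C X.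

(** Divide by a_0, ..., a_(l-1) one at a time; each step is a cone. *)
Lemma koszul_quo (K : lmodType R) n p : depth a K n -> has_resolution C K p ->
  forall l, (l <= n)%N ->
  has_resolution C (quo (mults_submod a K l) : lmodType R) (p + l).
Proof.
move=> dK resK; have resl l := quo_piE (mults_submod a K l).
elim=> [|l IH] lel.
  rewrite addn0; apply: (has_resolution_bij (f := quo_pi (mults_submod a K 0))) resK.
  have pi_inj : injective (quo_pi (mults_submod a K 0)).
    by move=> x y /resl /subr0_eq.
  have [g gK] := choice (@quo_surj _ _ (mults_submod a K 0)).
  by exists g => // x; apply: pi_inj; rewrite gK.
pose pi : {linear K -> quo (mults_submod a K l)} := quo_pi (mults_submod a K l).
pose pi' : {linear K -> quo (mults_submod a K l.+1)} := quo_pi (mults_submod a K l.+1).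
have pi0 x : pi x = 0 <-> mults a l x := quo_pi_eq0 (mults_submod a K l) x.
have pi'0 x : pi' x = 0 <-> mults a l.+1 x := quo_pi_eq0 (mults_submod a K l.+1) x.
have pi_surj x : exists y, pi y = x := quo_surj x.
have [|q qE] := @factor_through _ _ _ _ pi pi' pi_surj.
  by move=> x /pi0 Bx; apply/pi'0; exists 0; rewrite scaler0 subr0.
rewrite addnS; apply: (cone_resolution (a := a l) (q := q)) (IH (ltnW lel)) => //.
split.
- move=> x y; have [u <-] := pi_surj x; have [v <-] := pi_surj y.
  rewrite /= /hom_scale -!linearZ => /resl; rewrite -scalerBr => Buv.
  by apply/resl/dK.
- move=> x; have [u <-] := pi_surj x; rewrite qE; split=> [/pi'0[y /pi0]|[y]].
    by rewrite linearB linearZ => /subr0_eq yE; exists (pi y).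
  have [v <-] := pi_surj y; rewrite /= /hom_scale -linearZ => /esym/resl Buv.
  by apply/pi'0; exists v.
- by move=> x; have [u uE] := quo_surj x; exists (pi u); rewrite qE.
Qed.

Lemma koszul_resolution (K M : lmodType R) (e : {linear K -> M}) n p :
  depth a K n -> (forall m, exists x, e x = m) ->
  (forall x, e x = 0 <-> mults a n x) ->
  has_resolution C K p -> has_resolution C M (p + n).
Proof.
move=> dK e_surj eE /(koszul_quo dK)/(_ n (leqnn n)).
pose pi : {linear K -> quo (mults_submod a K n)} := quo_pi (mults_submod a K n).
have pi0 x : pi x = 0 <-> mults a n x := quo_pi_eq0 (mults_submod a K n) x.
have [|q qE] := @factor_through _ _ _ _ pi e (@quo_surj _ _ _).
  by move=> x /pi0/eE.
apply: (has_resolution_bij (f := q)).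
have q_inj : injective q.
  move=> x y; have [u <-] := quo_surj x; have [v <-] := quo_surj y.
  rewrite !qE => euv; apply/subr0_eq; rewrite -linearB; apply/pi0/eE.
  by rewrite linearB euv subrr.
have q_surj m : exists x, q x = m.
  by have [x <-] := e_surj m; exists (pi x); rewrite qE.
have [g gK] := choice q_surj.
by exists g => // x; apply: q_inj; rewrite gK.
Qed.
End Koszul.

Section Dimensions.
Variables (R : comNzRingType) (s N c a : nat -> R) (n : nat).
Hypothesis sN : forall j, exact_pair (s j) (N j).
Hypothesis Ns : forall j, exact_pair (N j) (s j).
Hypothesis sc : forall j, s j = c j * s j.+1.
Hypothesis Nc : forall j, N j.+1 = c j * N j.

(** The elements of the ideal generated by a_0, ..., a_(l-1) and all s_j: by
exactness of the pairs, N_j u = 0 means that u is a multiple of s_j. *)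
Definition loc_mults l (r : R) : Prop :=
  exists (y : R^o) j, mults a l y /\ N j * (r - y) = 0.

Lemma norm_raise j (u : R) m : N j * u = 0 -> N (m + j) * u = 0.
Proof. by move=> Nu; elim: m => [//|m IH]; rewrite addSn Nc -mulrA IH mulr0. Qed.

Definition loc_submod (l : nat) : submod R^o.
Proof.
exists (loc_mults l : R^o -> Prop).
- exists 0, 0%N; split; first exact: mults0.
  by rewrite subr0 mulr0.
- move=> r r' [y [j [By ry]]] [y' [j' [By' ry']]].
  exists (y + y'), (j + j')%N; split; first exact: multsD.
  have -> : r + r' - (y + y') = (r - y) + (r' - y') by rewrite opprD addrACA.
  have -> : N (j + j')%N * (r - y + (r' - y')) =
      N (j' + j)%N * (r - y) + N (j + j')%N * (r' - y') by rewrite addnC mulrDr.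
  by rewrite !norm_raise // addr0.
- move=> b r [y [j [By ry]]]; exists (b *: y), j; split; first exact: multsZ.
  by rewrite -[_ - _]/(b * r - b * y) -mulrBr mulrCA ry mulr0.
Defined.

Variables (M : lmodType R) (e : {linear R^o -> M}).
Hypothesis dR : depth a R^o n.
Hypothesis sR : forall r : R^o, (forall j, mults a n (s j *: r)) -> mults a n r.
Hypothesis dJ : forall l, (l < n)%N ->
  forall r, loc_mults l (a l * r) -> loc_mults l r.
Hypothesis e_surj : forall m, exists r, e r = m.
Hypothesis eE : forall r, e r = 0 <-> loc_mults n r.
Hypothesis e1 : e 1 <> 0.

Let K : lmodType R := colim_ker sc.
Let nuK : {linear R^o -> K} :=
  cores (fun r => exact_comp0 r (nu_gamma sN Ns sc Nc) : ker_submod (gamma sc) (nu N c r)).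

Let nuK_surj x : exists r, nuK r = x.
Proof.
have gx : gamma sc (subm_val x) = 0 := subm_valP x.
have /(nu_gamma sN Ns sc Nc)[r rE] := gx.
by exists r; apply: subm_val_inj.
Qed.

Let nuK_mults l (r : R^o) : mults a l (nuK r) <-> loc_mults l r.
Proof.
have nuK0 (u : R^o) : nuK u = 0 <-> exists j, N j * u = 0.
  split=> [/(congr1 (@subm_val _ _ _))/(nu_eq0 Nc)[j uN]|[j uN]].
    by exists j; rewrite mulrC.
  by apply: subm_val_inj; rewrite [LHS](nuE Nc j) mulrC uN scale0r.
split=> [/(mults_lift nuK_surj)[y [yE By]]|[y [j [By ry]]]].
  have /nuK0[j rj] : nuK (r - y) = 0 by rewrite linearB yE subrr.
  by exists y, j.
have -> : nuK r = nuK y.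
  by apply/subr0_eq; rewrite -linearB; apply/nuK0; exists j.
exact: mults_map.
Qed.

Let K_depth : depth a K n.
Proof.
move=> l ltl x; have [r <-] := nuK_surj x.
by rewrite -linearZ => /nuK_mults/(dJ ltl)/nuK_mults.
Qed.

Let resolve (C : lmodType R -> Prop) p :
  (forall X Y, C X -> C Y -> C (X * Y)%type) ->
  (forall X, zero_module X -> C X) ->
  has_resolution C K p -> has_resolution C M (p + n).
Proof.
move=> CP CZ; have [|f fE] := @factor_through _ _ _ _ nuK e nuK_surj.
  move=> r r0; apply/eE/nuK_mults; rewrite r0; exact: mults0.
apply: (@koszul_resolution _ a C CP CZ K M f n p K_depth).
  by move=> m; have [r <-] := e_surj m; exists (nuK r).
by move=> x; have [r <-] := nuK_surj x; rewrite fE eE nuK_mults.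
Qed.

(** The module K is the quotient of R by the s_j, and M is K modulo the a_l.
So resolutions of K of length 1 by PGF modules and of length 0 by Gorenstein
flat ones become resolutions of M that are longer by n; the image of 1 in M is
the element from which [no_resolution] derives that none is shorter. *)
Theorem gorenstein_dimensions :
  [/\ Gfd M = Some n, PGF_dim M = Some n.+1 & Gpd M = Some n.+1].
Proof.
pose T t := (exists2 l, (l < n)%N & t = a l) \/ exists j, t = s j.
have Ta l : (l < n)%N -> T (a l) by move=> ltl; left; exists l.
have Te t : T t -> t *: e 1 = 0.
  rewrite -linearZ => Tt; apply/eE; case: Tt => [[l ltl ->]|[j ->]].
    exists (a l *: 1), 0%N; rewrite subrr mulr0; split=> //; exact: mults_gen.
  exists 0, j; split; first exact: mults0.
  by rewrite subr0 -[_ *: _]/(s j * 1) mulr1; exact: exact_pair0.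
have sTR (r : R^o) : (forall t, T t -> mults a n (t *: r)) -> mults a n r.
  by move=> Tr; apply: sR => j; apply: Tr; right; exists j.
have resX : has_resolution (periodic (@projective_module R) (@proj_total R)) K 1.
  apply: (has_resolutionS (telescope_exact sc)).
    exact: (periodic_tel sN Ns).
  exact: has_resolution0 (periodic_tel sN Ns).
have resK : has_resolution (periodic (@flat_module R) (@inj_tensor_exact R)) K 0.
  exact: has_resolution0 (periodic_colim_ker sN Ns sc Nc).
have {resK} resK := resolve _ _ resK.
have {resX} resX := resolve _ _ resX.
split; apply: resolution_dim_eq => [|m ltm].
- apply: has_resolution_sub (@periodic_GF R) _; apply: resK => [X Y|X].
    exact: periodic_prod (@flat_prod R) (@inj_tensor_exact_prod R).
  exact: periodic_zero (@flat_zero R) (@inj_tensor_exact_zero R).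
- exact: (no_GF_resolution dR Ta e1 Te).
- apply: has_resolution_sub (@periodic_PGF R) _; apply: resX => [X Y|X].
    exact: periodic_prod (@projective_prod R) (@proj_total_prod R).
  exact: periodic_zero (@projective_zero R) (@proj_total_zero R).
- exact: (no_projective_resolution dR Ta e1 Te sTR (@PGF_coresolving R)).
- apply: has_resolution_sub (@periodic_GP R) _; apply: resX => [X Y|X].
    exact: periodic_prod (@projective_prod R) (@proj_total_prod R).
  exact: periodic_zero (@projective_zero R) (@proj_total_zero R).
- exact: (no_projective_resolution dR Ta e1 Te sTR (@GP_coresolving R)).
Qed.
End Dimensions.

(** * Group algebras of abelian groups *)

Definition mul_group (V : zmodType) : Type := V.
HB.instance Definition _ (V : zmodType) := Choice.on (mul_group V).
HB.instance Definition _ (V : zmodType) :=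
  isGroup.Build (mul_group V) (@addrA V) (@add0r V) (@addr0 V) (@addNr V) (@addrN V).

Section AbelianGroupAlgebra.
Variables (k : comNzRingType) (V : zmodType).
Notation kV := (group_alg k (mul_group V)).

Fact ga_mulC : commutative (@ga_mul k (mul_group V)).
Proof.
move=> a b; elim/ga_ind: a => [|a a' IH IH'|r x].
- by rewrite ga_0mul ga_mul0.
- by rewrite ga_mulDl ga_mulDr IH IH'.
elim/ga_ind: b => [|b b' IH IH'|t y].
- by rewrite ga_0mul ga_mul0.
- by rewrite ga_mulDl ga_mulDr IH IH'.
by rewrite !ga_mulUU mulrC; congr << _ *g _ >>; exact: addrC.
Qed.
HB.instance Definition _ := GRing.PzRing_hasCommutativeMul.Build kV ga_mulC.

Definition gelt (v : V) : kV := << (v : mul_group V) >>.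

Lemma mulUU (r t : k) (x y : V) :
  (<< r *g (x : mul_group V) >> : kV) * << t *g (y : mul_group V) >> =
  << r * t *g (x + y : mul_group V) >>.
Proof. exact: ga_mulUU. Qed.

Lemma gelt0 : gelt 0 = 1. Proof. by []. Qed.

Lemma geltD u v : gelt (u + v) = gelt u * gelt v.
Proof. by rewrite [RHS]mulUU mulr1. Qed.

Lemma geltMn v m : gelt (v *+ m) = gelt v ^+ m.
Proof. by elim: m => [//|m IH]; rewrite mulrS geltD IH exprS. Qed.

(** [ga_ind] with the elements of the group written in V. *)
Lemma ga_expand (P : kV -> Prop) : P 0 -> (forall a b, P a -> P b -> P (a + b)) ->
  (forall r (x : V), P << r *g (x : mul_group V) >>) -> forall a, P a.
Proof. exact: ga_ind. Qed.

Lemma gelt_mulU v r (x : V) :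
  gelt v * << r *g (x : mul_group V) >> = << r *g (v + x : mul_group V) >>.
Proof. by rewrite mulUU mul1r. Qed.

Lemma coef_gelt v (r : kV) (x : V) : (gelt v * r)@_x = r@_(x - v : V).
Proof.
elim/ga_expand: r => [|a b IHa IHb|t y].
- by rewrite mulr0 !mcoeff0.
- by rewrite mulrDr !mcoeffD IHa IHb.
rewrite gelt_mulU !mcoeffU; congr (_ *+ nat_of_bool _).
by rewrite addrC; apply/eqP/eqP => [<-|->]; rewrite ?addrK ?subrK.
Qed.

(** The support of r is finite, and it is stable under infinitely many
translations. *)
Lemma invariant_eq0 (r : kV) (f : nat -> V) : injective f ->
  (forall i (x : V), r@_(x - f i : V) = r@_x) -> r = 0.
Proof.
move=> f_inj rf; apply/malgP => x; rewrite mcoeff0; apply/eqP/negPn/negP => rx.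
pose m := size (msupp r).
pose l : seq (mul_group V) := [seq (x : V) - f i | i <- iota 0 m.+1].
have : (size l <= size (msupp r))%N.
  apply: uniq_leq_size.
    rewrite map_inj_uniq ?iota_uniq // => i j /addrI/oppr_inj; exact: f_inj.
  by move=> y /mapP[i _ ->]; rewrite -mcoeff_neq0 rf.
by rewrite size_map size_iota ltnn.
Qed.

Section Push.
Variable q : {additive V -> V}.

(** The ring endomorphism of kV induced by the endomorphism q of V.  It models
the quotient by the elements v - q v of V, with no change of group. *)
Definition push : {linear {malg k[mul_group V]} -> kV} :=
  malg_ext (fun x : V => gelt (q x)).

Lemma pushU r (x : V) :
  push << r *g (x : mul_group V) >> = << r *g (q x : mul_group V) >>.
Proof.
rewrite /push /= malg_extU; apply/malgP => y.
by rewrite mcoeffZ !mcoeffU; case: (_ == _); rewrite ?mulr1 ?mulr0.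
Qed.

Lemma pushD (r t : kV) : push (r + t) = push r + push t.
Proof. exact: linearD. Qed.
Lemma pushB (r t : kV) : push (r - t) = push r - push t.
Proof. exact: linearB. Qed.
Lemma push0 : push (0 : kV) = 0.
Proof. exact: linear0. Qed.

Lemma push_gelt v : push (gelt v) = gelt (q v).
Proof. exact: pushU. Qed.

Lemma pushM (r t : kV) : push (r * t) = push r * push t.
Proof.
elim/ga_expand: r => [|a b IHa IHb|r x].
- by rewrite push0 !mul0r push0.
- by rewrite mulrDl !pushD IHa IHb mulrDl.
elim/ga_expand: t => [|a b IHa IHb|t y].
- by rewrite push0 !mulr0 push0.
- by rewrite mulrDr !pushD IHa IHb mulrDr.
by rewrite mulUU !pushU mulUU raddfD.
Qed.

(** Modulo J an element r is the same as its push-forward. *)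
Lemma push_ideal (J : submod kV^o) :
  (forall v, J (gelt v - gelt (q v))) -> forall r : kV, push r = 0 -> J r.
Proof.
move=> Jq r r0; rewrite -[r]subr0 -r0 {r0}.
elim/ga_expand: r => [|a b IHa IHb|t x].
- by rewrite push0 subr0; apply: submod0.
- by rewrite pushD opprD addrACA; apply: submodD.
rewrite pushU.
have -> : << t *g (x : mul_group V) >> - << t *g (q x : mul_group V) >> =
   (<< t *g (0 : V) : mul_group V >> : kV) * (gelt x - gelt (q x)).
  by rewrite mulrBr !mulUU !mulr1 !add0r.
exact: submodZ (Jq x).
Qed.
End Push.

Section FiniteOrder.
Variables (g : V) (q : nat).
Hypotheses (gq : g *+ q = 0).
Hypothesis g_inj : forall i j, (i < q)%N -> (j < q)%N -> g *+ i = g *+ j -> i = j.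
Hypothesis q_gt0 : (0 < q)%N.

Let y : kV := gelt g.
Let yq : y ^+ q = 1. Proof. by rewrite -geltMn gq. Qed.

(** [choose] depends only on the extension of its predicate, so [rep] is
constant on the cosets of the cyclic group generated by g, and the fixed points
of [rep] are a transversal. *)
Let coset (x z : V) : bool := `[< exists m, z = x + g *+ m >].
Let rep (x : V) : V := choose (coset x) x.

Let rep_shift x m : rep (x + g *+ m) = rep x.
Proof.
have cosetE x' m' : coset (x' + g *+ m') =1 coset x'.
  move=> z; apply/asboolP/asboolP => -[u ->].
    by exists (m' + u)%N; rewrite mulrnDr addrA.
  exists (u + q.-1 * m')%N; rewrite -addrA -mulrnDr addnCA.
  rewrite -{1}[m']mul1n -mulnDl add1n prednK // mulrnDr mulrnA gq mul0rn addr0.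
  by [].
rewrite /rep (eq_choose (cosetE x m)).
apply: choose_id; apply/asboolP; last by exists 0%N; rewrite addr0.
by exists m.
Qed.

Let rep_coset x : exists2 m, (m < q)%N & rep x = x + g *+ m.
Proof.
have /asboolP[m mE] : coset x (rep x).
  by apply: (@chooseP _ (coset x)); apply/asboolP; exists 0%N; rewrite addr0.
exists (m %% q)%N; first exact: ltn_pmod.
by rewrite mE {1}(divn_eq m q) mulrnDr mulnC mulrnA gq mul0rn add0r.
Qed.

Let restr : {linear {malg k[mul_group V]} -> kV} :=
  malg_ext (fun x : V => if rep x == x then gelt x else 0).

(** The identity of kV is the norm of [restr]: the translates of the transversal
partition V.  This relative projectivity is what makes the pair of s and the norm
exact. *)
Let trace (r : kV) : \sum_(i < q) y ^+ (q - i) * restr (y ^+ i * r) = r.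
Proof.
elim/ga_expand: r => [|a b IHa IHb|t x].
- by rewrite big1 // => i _; rewrite mulr0 linear0 mulr0.
- rewrite -[in RHS]IHa -[in RHS]IHb -big_split; apply: eq_bigr => i _ /=.
  by rewrite -mulrDr; congr (_ * _); rewrite mulrDr; exact: linearD.
have [m ltm repE] := rep_coset x.
have restrE i : restr (y ^+ i * << t *g (x : mul_group V) >>) =
    if rep x == x + g *+ i then << t *g (x + g *+ i : mul_group V) >> else 0.
  rewrite -geltMn gelt_mulU /restr /= malg_extU [_ + x]addrC rep_shift.
  case: eqP => _; last by rewrite scaler0.
  apply/malgP => z; rewrite mcoeffZ !mcoeffU.
  by case: (_ == _); rewrite ?mulr1 ?mulr0.
rewrite (bigD1 (Ordinal ltm)) //= big1 ?addr0 => [|i].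
  rewrite restrE repE eqxx -geltMn gelt_mulU; congr << _ *g _ >>.
  by rewrite addrCA -mulrnDr subnK ?gq ?addr0 // ltnW.
rewrite -val_eqE /= restrE repE => neq; case: eqP => [/addrI/g_inj e|]; last by rewrite mulr0.
by rewrite -e ?eqxx // in neq.
Qed.

Definition norm_elt : kV := \sum_(i < q) gelt g ^+ i.

(** If g fixes r then [trace] exhibits r as a norm. *)
Lemma exact_pair_norm : exact_pair (gelt g - 1) norm_elt.
Proof.
move=> r; split=> [yr|[r' ->]]; last by rewrite mulrA -subrX1 yq subrr mul0r.
have {}yr : y * r = r by apply/subr0_eq; rewrite -[X in _ - X]mul1r -mulrBl.
have yir i : y ^+ i * r = r.
  by elim: i => [|i IH]; rewrite ?mul1r // exprSr -mulrA yr.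
exists (y * restr r); rewrite -[LHS]trace /norm_elt mulr_suml.
rewrite [LHS](reindex_inj rev_ord_inj) /=; apply: eq_bigr => i _.
by rewrite yir subKn // exprSr mulrA.
Qed.

(** In [trace] replace each y^(q-i) by y^(q-i) - 1, a multiple of y - 1.  The
correction is [restr] of the norm of r, which is zero. *)
Lemma norm_exact_pair : exact_pair norm_elt (gelt g - 1).
Proof.
move=> r; split=> [Nr|[r' ->]].
  have : \sum_(i < q) restr (y ^+ i * r) = 0.
    have -> : \sum_(i < q) restr (y ^+ i * r) = restr (norm_elt * r).
      by rewrite /norm_elt mulr_suml; exact/esym/linear_sum.
    by rewrite Nr; exact: linear0.
  move=> restr0; exists (\sum_(i < q) (\sum_(j < q - i) y ^+ j) * restr (y ^+ i * r)).
  transitivity (\sum_(i < q) (y ^+ (q - i) * restr (y ^+ i * r) - restr (y ^+ i * r))).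
    by rewrite sumrB trace restr0 subr0.
  rewrite mulr_sumr; apply: eq_bigr => i _.
  by rewrite mulrA -subrX1 mulrBl mul1r.
by rewrite mulrA [norm_elt * _]mulrC -subrX1 yq subrr mul0r.
Qed.
End FiniteOrder.
End AbelianGroupAlgebra.

(** * The rationals modulo the integers *)

Lemma geometric_sum_mul (R : comNzRingType) (y : R) m q :
  \sum_(i < m * q) y ^+ i = (\sum_(i < m) y ^+ i) * \sum_(i < q) (y ^+ m) ^+ i.
Proof.
elim: q => [|q IH]; first by rewrite muln0 !big_ord0 mulr0.
rewrite mulnS addnC big_split_ord /= IH big_ord_recr /= mulrDr; congr (_ + _).
rewrite mulr_suml; apply: eq_bigr => i _.
by rewrite -exprM exprD mulrC.
Qed.

(** Q/Z is formed as a quotient of modules over the integers. *)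
Definition int_submod : submod (zmodule rat : lmodType int).
Proof.
exists (fun x => exists m : int, (x : rat) = m%:~R).
- by exists 0.
- by move=> x y [m ->] [m' ->]; exists (m + m'); rewrite rmorphD.
- by move=> a x [m ->]; exists (m * a); rewrite scalezrE rmorphM /= -mulrzr.
Defined.

Definition QZ : zmodType := quo int_submod.
Definition qz (x : rat) : QZ := quo_pi int_submod (x : zmodule rat).

Lemma qz_eq x y : qz x = qz y <-> exists m : int, x - y = m%:~R.
Proof. exact: (quo_piE int_submod). Qed.

Lemma qzMz x m : qz (x *~ m) = qz x *~ m.
Proof. exact: (raddfMz (quo_pi int_submod)). Qed.

Lemma qzMn x m : qz (x *+ m) = qz x *+ m.
Proof. exact: (raddfMn (quo_pi int_submod)). Qed.

Lemma qz_int m : qz m%:~R = 0.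
Proof.
have -> : 0 = qz 0 by apply/esym/(linear0 (quo_pi int_submod)).
by apply/qz_eq; exists m; rewrite subr0.
Qed.

Lemma qz_surj (h : QZ) : exists x, qz x = h.
Proof. exact: (quo_surj h). Qed.

(** The reciprocals 1/(j+1)!, starting from (j+1)! instead of j!: the classes of
1/0! and 1/1! in Q/Z would coincide, whereas these are pairwise distinct. *)
Definition inv_fact j : rat := (j.+1)`!%:R^-1.

Lemma inv_factS j : inv_fact j = inv_fact j.+1 *+ j.+2.
Proof.
rewrite /inv_fact [in RHS]factS natrM invfM -[RHS]mulr_natl mulrA divff ?mul1r //.
by rewrite pnatr_eq0.
Qed.

Lemma fact_neq0 j : (j.+1)`!%:R != 0 :> rat.
Proof. by rewrite pnatr_eq0 -lt0n fact_gt0. Qed.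

Lemma inv_fact_order j : qz (inv_fact j) *+ (j.+1)`! = 0.
Proof.
rewrite -qzMn -[inv_fact j *+ _]mulr_natl divff ?fact_neq0 //.
exact: (qz_int 1).
Qed.

Lemma int_small (x : rat) m : x = m%:~R -> `|x| < 1 -> x = 0.
Proof.
by move=> ->; rewrite -intr_norm ltrz1 -[1]add0r ltzD1 normr_le0 => /eqP ->.
Qed.

Lemma inv_fact_inj j i i' : (i < (j.+1)`!)%N -> (i' < (j.+1)`!)%N ->
  qz (inv_fact j) *+ i = qz (inv_fact j) *+ i' -> i = i'.
Proof.
have q_gt0 : 0 < (j.+1)`!%:R :> rat by rewrite ltr0n fact_gt0.
have small l : (l < (j.+1)`!)%N -> 0 <= inv_fact j *+ l < 1.
  move=> ltl; rewrite -[_ *+ l]mulr_natl ltr_pdivrMr // mul1r ltr_nat ltl andbT.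
  by rewrite divr_ge0 ?ler0n.
move=> /small lti /small lti'; rewrite -!qzMn => /qz_eq[m mE].
have /subr0_eq : inv_fact j *+ i - inv_fact j *+ i' = 0.
  apply: int_small mE _; rewrite ltr_norml; lra.
by apply: mulrIn; rewrite invr_eq0 fact_neq0.
Qed.

Lemma inv_fact_distinct i j : qz (inv_fact i) = qz (inv_fact j) -> i = j.
Proof.
have small l : 0 < inv_fact l <= 1.
  by rewrite invr_gt0 ltr0n fact_gt0 invf_le1 ?ler1n ?ltr0n fact_gt0.
move=> /qz_eq[m mE]; have /subr0_eq : inv_fact i - inv_fact j = 0.
  apply: int_small mE _; have := small i; have := small j; rewrite ltr_norml; lra.
move=> /invr_inj/eqP; rewrite eqr_nat => /eqP.
case: (ltngtP i j) => // lt_ij e.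
  by have := @ltn_fact i.+1 j.+1 isT lt_ij; rewrite e ltnn.
by have := @ltn_fact j.+1 i.+1 isT lt_ij; rewrite e ltnn.
Qed.

Lemma qz_torsion (h : QZ) : exists j (m : int), h = qz (inv_fact j) *~ m.
Proof.
have [x <-] := qz_surj h; pose d := `|denq x|%N.
have d_gt0 : (0 < d)%N by rewrite absz_gt0 denq_neq0.
have dE : (d : int) = denq x by rewrite gez0_abs // ltW // denq_gt0.
have /dvdnP[q qE] : (d %| d.+1`!)%N by rewrite dvdn_fact // d_gt0 leqnSn.
exists d, (numq x * q); rewrite -qzMz; congr qz.
have q_neq0 : q%:R != 0 :> rat.
  by rewrite pnatr_eq0; apply: contraTneq (fact_gt0 d.+1) => q0; rewrite qE q0.
rewrite -[LHS]divq_num_den -dE -[RHS]mulrzr intrM /inv_fact qE natrM invfM.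
rewrite [_ * q%:~R]mulrC mulrACA -!pmulrn mulVf // mul1r mulrC.
by [].
Qed.

Definition witness n : zmodType := ('rV[int]_n * QZ)%type.

Lemma countable_witness n : countable [set: mul_group (witness n)]%classic.
Proof.
apply/countable_injP.
exists (fun v : 'rV[int]_n * QZ =>
  @choice.pickle ('rV[int]_n * rat)%type (v.1, (repr v.2 : rat))).
move=> [u h] [u' h'] _ _ /= /(pcan_inj (@choice.pickleK _))[-> e].
by rewrite -[h]quo_pi_repr e quo_pi_repr.
Qed.

(** * Groups that split as free abelian by torsion *)

Section SplitGroup.
Variables (k : comNzRingType) (n : nat) (V : zmodType).
Notation R := (group_alg k (mul_group V)).
(** The group Z^n x Q/Z described by generators and projections: [tor j]
generates the j-th finite cyclic subgroup and has order [ord j], the [tra l]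
generate Z^n, the projection [pt l] kills the first l coordinates of Z^n, and
[pf l] kills the torsion as well. *)
Variables (tor : nat -> V) (ord idx : nat -> nat) (tra : nat -> V).
Variables (pt pf : nat -> {additive V -> V}).
Hypothesis tor_order : forall j, tor j *+ ord j = 0.
Hypothesis tor_order_inj : forall j i i', (i < ord j)%N -> (i' < ord j)%N ->
  tor j *+ i = tor j *+ i' -> i = i'.
Hypothesis ord_gt0 : forall j, (0 < ord j)%N.
Hypothesis ordS : forall j, ord j.+1 = (idx j * ord j)%N.
Hypothesis torS : forall j, tor j = tor j.+1 *+ idx j.
Hypothesis tor_inj : injective tor.
Hypothesis tra_inj : forall l, (l < n)%N -> injective (fun i => tra l *+ i).
Hypothesis pt_tra_lt : forall l i, (i < l)%N -> pt l (tra i) = 0.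
Hypothesis pf_tra_lt : forall l i, (i < l)%N -> pf l (tra i) = 0.
Hypothesis pt_tra : forall l, pt l (tra l) = tra l.
Hypothesis pf_tra : forall l, pf l (tra l) = tra l.
Hypothesis pt_tor : forall l j, pt l (tor j) = tor j.
Hypothesis pf_tor : forall l j, pf l (tor j) = 0.
Hypothesis pt0 : forall v, pt 0 v = v.
Hypothesis ptS : forall l v, (l < n)%N ->
  exists m : int, pt l v = pt l.+1 v + tra l *~ m.
Hypothesis ptf : forall l v, exists j (m : int), pt l v = pf l v + tor j *~ m.
Hypothesis pfn : forall v, pf n v = 0.

Let s j : R := gelt k (tor j) - 1.
Let N j : R := norm_elt k (tor j) (ord j).
Let c j : R := norm_elt k (tor j.+1) (idx j).
Let a l : R := gelt k (tra l) - 1.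

Let sN j : exact_pair (s j) (N j).
Proof. by apply: exact_pair_norm; [|apply: tor_order_inj|]. Qed.

Let Ns j : exact_pair (N j) (s j).
Proof. by apply: norm_exact_pair; [|apply: tor_order_inj|]. Qed.

Let sc j : s j = c j * s j.+1.
Proof. by rewrite mulrC /s torS geltMn subrX1. Qed.

Let Nc j : N j.+1 = c j * N j.
Proof. by rewrite /N /c /norm_elt ordS geometric_sum_mul -geltMn -torS. Qed.

Lemma push1 (q : {additive V -> V}) : push k q (1 : R) = 1.
Proof. by rewrite -(gelt0 k V) push_gelt raddf0. Qed.

Lemma push_gelt1 (q : {additive V -> V}) v : push k q (gelt k v - 1) = gelt k (q v) - 1.
Proof. by rewrite pushB push_gelt push1. Qed.

Lemma push_mults (q : {additive V -> V}) l (r : R^o) :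
  (forall i, (i < l)%N -> q (tra i) = 0) -> mults a l r -> push k q r = 0.
Proof.
elim: l r => [|l IH] r qt /=; first by move=> ->; exact: push0.
move=> [u Bu]; have ru : push k q (r - a l * u : R) = 0.
  by apply: IH Bu => i lti; apply/qt/ltnW.
move: ru; rewrite pushB pushM push_gelt1 qt // gelt0 subrr mul0r subr0.
by [].
Qed.

Lemma mults_ring l (r : R) :
  mults a l.+1 (r : R^o) <-> exists u : R, mults a l (r - a l * u : R^o).
Proof. by []. Qed.

Lemma gelt_mulz (v : V) (m : int) :
  exists u : R, gelt k (v *~ m) - 1 = (gelt k v - 1) * u.
Proof.
case: m => m; first by rewrite -pmulrn geltMn subrX1; eexists.
exists (- gelt k (v *~ Negz m) * \sum_(i < m.+1) gelt k v ^+ i).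
rewrite mulrCA -subrX1 -geltMn mulrBr mulr1 !mulNr opprK -geltD.
by rewrite NegzE mulrNz -pmulrn addNr gelt0 addrC.
Qed.

Lemma gelt_pt l (v : V) : (l <= n)%N -> mults a l (gelt k v - gelt k (pt l v) : R^o).
Proof.
elim: l => [|l IH] lel; first by rewrite pt0 subrr.
have [m mE] := ptS v lel.
have [u uE] := gelt_mulz (tra l) m.
apply/mults_ring; exists (gelt k (pt l.+1 v) * u).
rewrite mulrCA -uE mulrBr mulr1 -geltD -mE opprB addrA subrK.
exact: IH (ltnW lel).
Qed.

(** The ideal (a_0, ..., a_(l-1)) is the kernel of the ring endomorphism induced
by the projection [pt l]; so regularity can be checked in kV. *)
Lemma mults_push l (r : R^o) : (l <= n)%N -> mults a l r <-> push k (pt l) r = 0.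
Proof.
move=> lel; split; first by apply: push_mults => i; apply: pt_tra_lt.
apply: (@push_ideal k V (pt l) (mults_submod a R^o l)) => v.
exact: gelt_pt.
Qed.

Lemma gelt_fixed (r : R) v m : (gelt k v - 1) * r = 0 -> gelt k (v *+ m) * r = r.
Proof.
rewrite mulrBl mul1r => /subr0_eq vr.
by elim: m => [|m IH]; rewrite ?mulr0n ?gelt0 ?mul1r // mulrSr geltD -mulrA vr.
Qed.

(** An element killed by a_l is invariant under the infinitely many multiples
of [tra l]. *)
Lemma translation_regular l (r : R) : (l < n)%N -> a l * r = 0 -> r = 0.
Proof.
move=> ltl ar; apply: (invariant_eq0 (f := fun i => tra l *+ i)); first exact: tra_inj.
by move=> i x; rewrite -coef_gelt gelt_fixed.
Qed.

(** An element killed by all s_j is invariant under all [tor j]; this is where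
the torsion part has to be infinite. *)
Lemma torsion_regular (r : R) : (forall j, s j * r = 0) -> r = 0.
Proof.
move=> sr; apply: (invariant_eq0 tor_inj) => i x.
have sri : gelt k (tor i *+ 1) * r = r by apply/gelt_fixed/sr.
by rewrite mulr1n in sri; rewrite -coef_gelt sri.
Qed.

Let dR : depth a R^o n.
Proof.
move=> l ltl r /(mults_push _ (ltnW ltl)) ar; apply/(mults_push _ (ltnW ltl)).
apply: (translation_regular ltl); rewrite -[RHS]ar.
have -> : a l *: r = (a l : R) * r by [].
by rewrite pushM push_gelt1 pt_tra.
Qed.

Let sR (r : R^o) : (forall j, mults a n (s j *: r)) -> mults a n r.
Proof.
move=> sr; apply/(mults_push _ (leqnn n)); apply: torsion_regular => j.
have /(mults_push _ (leqnn n)) {}sr := sr j; rewrite -[RHS]sr.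
have -> : s j *: r = (s j : R) * r by [].
by rewrite pushM push_gelt1 pt_tor.
Qed.

Let loc l := loc_mults N a l.

(** Likewise, adding all s_j to the ideal amounts to using [pf l]. *)
Lemma loc_push l (r : R) : (l <= n)%N -> loc l r <-> push k (pf l) r = 0.
Proof.
move=> lel; split=> [[y [j [By]]]|].
  move=> /Ns[u /(canRL (subrK _))->].
  rewrite pushD pushM push_gelt1 pf_tor gelt0 subrr mul0r add0r.
  by apply: push_mults By => i; apply: pf_tra_lt.
apply: (@push_ideal k V (pf l) (@loc_submod R N c a Nc l)) => v.
have -> : gelt k v - gelt k (pf l v) =
    (gelt k v - gelt k (pt l v)) + (gelt k (pt l v) - gelt k (pf l v)) by rewrite addrA subrK.
apply: submodD.
  exists (gelt k v - gelt k (pt l v)), 0%N; split; first exact: gelt_pt.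
  by rewrite subrr mulr0.
have [j [m mE]] := ptf l v; have [u uE] := gelt_mulz (tor j) m.
exists 0, j; split; first exact: mults0.
have -> : gelt k (pt l v) - gelt k (pf l v) - 0 = s j * (gelt k (pf l v) * u).
  by rewrite subr0 mE geltD mulrCA -uE mulrBr mulr1.
by rewrite [LHS]mulrA (exact_pair0 (Ns j)) mul0r.
Qed.

Let dJ l : (l < n)%N -> forall r, loc l (a l * r) -> loc l r.
Proof.
move=> ltl r /(loc_push _ (ltnW ltl)) ar; apply/(loc_push _ (ltnW ltl)).
by apply: (translation_regular ltl); rewrite -[RHS]ar pushM push_gelt1 pf_tra.
Qed.

Lemma push_pfn (r : R) :
  push k (pf n) r = << augmentation r *g (0 : mul_group V) >>.
Proof.
elim/ga_expand: r => [|u v IHu IHv|r x].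
- by rewrite push0 raddf0 monalgU0.
- by rewrite pushD IHu IHv raddfD monalgUD.
by rewrite pushU pfn augmentationU.
Qed.

Let M : lmodType R := trivial_module k.

Let aug (r : R^o) : M := augmentation r.
Let aug_lin : linear aug.
Proof.
move=> b r r'; rewrite /aug; apply: etrans (raddfD _ (b * r) r') _.
by congr (_ + _); exact: rmorphM.
Qed.

Theorem split_group_dimensions :
  [/\ Ghd k (mul_group V) = Some n, PGFcd k (mul_group V) = Some n.+1
    & Gcd k (mul_group V) = Some n.+1].
Proof.
pose e : {linear R^o -> M} :=
  HB.pack aug (GRing.isLinear.Build R R^o M _ aug aug_lin).
apply: (@gorenstein_dimensions R s N c a n sN Ns sc Nc M e dR sR dJ).
- by move=> m; exists (<< (m : k) *g (0 : mul_group V) >> : R); apply: augmentationU.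
- move=> r; split=> [er|/(loc_push _ (leqnn n))].
    by apply/(loc_push _ (leqnn n)); rewrite push_pfn [augmentation r]er monalgU0.
  by rewrite push_pfn => /eqP; rewrite monalgU_eq0 => /eqP.
have aug1 : augmentation (1 : R) = 1 by exact: rmorph1.
by move=> e1; have := oner_neq0 k; rewrite -aug1 => /eqP; apply; exact: e1.
Qed.
End SplitGroup.

(** * The group Z^n x Q/Z *)

Section Witness.
Variable n : nat.
Notation V := (witness n).

Definition tor j : V := (0, qz (inv_fact j)).
Definition tra l : V := (\row_i (i == l :> nat)%:R, 0).

Lemma tor_Mn j m : tor j *+ m = (0, qz (inv_fact j) *+ m).
Proof.
by elim: m => [//|m IH]; rewrite !mulrS IH; congr (_, _); rewrite /= addr0.
Qed.

Lemma torMz j m : tor j *~ m = (0, qz (inv_fact j) *~ m).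
Proof.
case: m => m; first by rewrite -!pmulrn tor_Mn.
by rewrite NegzE !mulrNz -!pmulrn tor_Mn; congr (_, _); rewrite oppr0.
Qed.

Lemma tra_Mn l m : tra l *+ m = (\row_i ((i == l :> nat)%:R *+ m), 0).
Proof.
elim: m => [|m IH]; first by congr (_, _); apply/rowP => i; rewrite !mxE.
rewrite mulrS IH; congr (_, _); rewrite ?add0r //=.
by apply/rowP => i; rewrite !mxE mulrS.
Qed.

Lemma traMz l m : tra l *~ m = (\row_i ((i == l :> nat)%:R *~ m), 0).
Proof.
case: m => m; first by rewrite -pmulrn tra_Mn.
rewrite NegzE mulrNz -pmulrn tra_Mn; congr (_, _); rewrite ?oppr0 //.
by apply/rowP => i; rewrite !mxE mulrNz.
Qed.

(** The flag b says whether the torsion coordinate is kept. *)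
Definition proj (b : bool) l (v : V) : V :=
  (\row_i (if (i < l)%N then 0 else v.1 0 i), if b then v.2 else 0).

Fact proj_is_zmod_morphism b l : zmod_morphism (proj b l).
Proof.
move=> u v; congr (_, _); last by case: b; rewrite /= ?subr0.
by apply/rowP => i; rewrite !mxE; case: ifP; rewrite ?subr0.
Qed.
HB.instance Definition _ b l :=
  GRing.isZmodMorphism.Build V V (proj b l) (proj_is_zmod_morphism b l).

Lemma proj_tra_lt b l i : (i < l)%N -> proj b l (tra i) = 0.
Proof.
move=> lti; congr (_, _); last by case: b.
apply/rowP => j; rewrite !mxE; case: ltnP => // lej.
by case: eqP => // jE; move: lej; rewrite jE leqNgt lti.
Qed.

Lemma proj_tra b l : proj b l (tra l) = tra l.
Proof.
congr (_, _); last by case: b.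
by apply/rowP => j; rewrite !mxE; case: ltngtP.
Qed.

Lemma proj_tor b l j : proj b l (tor j) = if b then tor j else 0.
Proof.
by case: b; congr (_, _); apply/rowP => i; rewrite !mxE if_same.
Qed.

Lemma proj0 v : proj true 0 v = v.
Proof.
by case: v => u h; congr (_, _); apply/rowP => i; rewrite !mxE.
Qed.

Lemma projS l v : (l < n)%N ->
  exists m : int, proj true l v = proj true l.+1 v + tra l *~ m.
Proof.
move=> ltl; exists (v.1 0 (Ordinal ltl)); rewrite traMz.
congr (_, _); rewrite /= ?addr0 //.
apply/rowP => i; rewrite !mxE ltnS; case: ltngtP => [lt|lt|iE].
- by rewrite /= mul0rz addr0.
- by rewrite /= mul0rz addr0.
by rewrite add0r intz; congr (v.1 _ _); apply: val_inj.
Qed.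

Lemma proj_false l v :
  exists j (m : int), proj true l v = proj false l v + tor j *~ m.
Proof.
have [j [m mE]] := qz_torsion v.2; exists j, m; rewrite torMz -mE.
by congr (_, _); rewrite /= ?addr0 ?add0r.
Qed.

Lemma proj_false_n v : proj false n v = 0.
Proof. by congr (_, _); apply/rowP => i; rewrite !mxE ltn_ord. Qed.

Lemma tra_inj l : (l < n)%N -> injective (fun i => tra l *+ i).
Proof.
move=> ltl i j; rewrite !tra_Mn => -[/rowP/(_ (Ordinal ltl))].
by rewrite !mxE eqxx /= => /eqP; rewrite eqr_nat => /eqP.
Qed.

Lemma witness_dimensions (k : comNzRingType) :
  [/\ Ghd k (mul_group V) = Some n, PGFcd k (mul_group V) = Some n.+1
    & Gcd k (mul_group V) = Some n.+1].
Proof.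
apply: (@split_group_dimensions k n V tor (fun j => (j.+1)`!) (fun j => j.+2) tra
  (fun l => proj true l) (fun l => proj false l)).
- by move=> j; rewrite tor_Mn inv_fact_order.
- by move=> j i i' lti lti'; rewrite !tor_Mn => -[/inv_fact_inj]; apply.
- by move=> j; exact: fact_gt0.
- by move=> j; exact: factS.
- by move=> j; rewrite tor_Mn -qzMn -inv_factS.
- by move=> i j [/inv_fact_distinct].
- exact: tra_inj.
- exact: proj_tra_lt.
- exact: proj_tra_lt.
- exact: proj_tra.
- exact: proj_tra.
- by move=> l j; rewrite /= proj_tor.
- by move=> l j; rewrite /= proj_tor.
- exact: proj0.
- exact: projS.
- exact: proj_false.
- exact: proj_false_n.
Qed.
End Witness.

Theorem proposition5p3 (k : comNzRingType) (hk : sfli k <> None) (n : nat) :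
  exists G : groupType,
    [/\ countable [set: G]%classic,
        Ghd k G = Some n,
        Gcd k G = PGFcd k G,
        PGFcd k G = Some n.+1
      & Some n.+1 = omap succn (Ghd k G)].
Proof.
have [ghd pgf gcd] := witness_dimensions n k.
exists (mul_group (witness n)); split; rewrite ?ghd ?pgf ?gcd //.
exact: countable_witness.
Qed.
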